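(* (1) Let $\Omega$ be a triangle in $\mathbb{R}^2$. If $\Omega$ satisfies the balance law at the origin, then $\Omega$ is an equilateral triangle centered at the origin. (2) Let $\Omega$ be a convex quadrangle in $\mathbb{R}^2$. If $\Omega$ satisfies the balance law at the origin, then $\Omega$ is a parallelogram centered at the origin.
   Context: Triangles and quadrangles are understood as (closed, solid) bodies in $\mathbb{R}^2$, a body being the closure of a bounded open set. $\Omega$ satisfies the balance law at the origin if $\int_{rS^{1}\cap\Omega} v\,d\sigma(v)=0$ for any $r\ge 0$, where $rS^1$ is the circle of radius $r$ centered at the origin and $\sigma$ is arc-length measure. *)

(* Defs.v *)
From HB Require Import structures.
From mathcomp Require Import all_boot all_order all_algebra.
From mathcomp Require Import all_classical all_reals all_analysis.
From mathcomp Require Import measurable_realfun.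

Set Implicit Arguments.
Unset Strict Implicit.
Unset Printing Implicit Defensive.

Import Order.TTheory GRing.Theory Num.Theory.
Import numFieldNormedType.Exports.

Local Open Scope classical_set_scope.
Local Open Scope ring_scope.

(* The plane is [R * R]; the library norm on a product is the sup norm, so the
   Euclidean one is introduced here. *)
Definition enorm {R : realType} (v : R * R) : R :=
  Num.sqrt (v.1 ^+ 2 + v.2 ^+ 2).

Definition edist {R : realType} (p q : R * R) : R := enorm (p - q).

Definition circle {R : realType} (r : R) : set (R * R) :=
  [set v | enorm v = r].

(* Unit-speed parametrization for [r > 0], [s] ranging over [0, 2 pi r[. *)
Definition circle_param {R : realType} (r s : R) : R * R :=
  (r * cos (s / r), r * sin (s / r)).

Lemma measurable_circle_param {R : realType} (r : R) :
  measurable_fun [set: R] (circle_param r).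
Proof.
have mr : measurable_fun [set: R] (fun s => s / r) by exact: measurable_funM.
apply: measurable_fun_pair; apply: measurable_funM => //.
- apply: (measurableT_comp _ mr).
  exact: (continuous_measurable_fun (@continuous_cos R)).
- apply: (measurableT_comp _ mr).
  exact: (continuous_measurable_fun (@continuous_sin R)).
Qed.

(* Image of the Lebesgue measure of [0, 2 pi r[ under the unit-speed
   parametrization; for [r = 0] it is the zero measure. *)
Definition arc_length {R : realType} (r : R) : set (R * R) -> \bar R :=
  pushforward
    (mrestr (@lebesgue_measure R) (measurable_itv `[0, 2 * pi * r[))
    (circle_param r).

Fact arc_length0 {R : realType} (r : R) : arc_length r set0 = 0%E.
Proof.
have mf := measurable_circle_param r.
exact: measure0.
Qed.

Fact arc_length_ge0 {R : realType} (r : R) A : (0 <= arc_length r A)%E.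
Proof.
have mf := measurable_circle_param r.
exact: measure_ge0.
Qed.

Fact arc_length_sigma_additive {R : realType} (r : R) :
  semi_sigma_additive (arc_length r).
Proof.
have mf := measurable_circle_param r.
exact: measure_semi_sigma_additive.
Qed.

HB.instance Definition _ {R : realType} (r : R) :=
  isMeasure.Build _ _ _ (arc_length r)
    (arc_length0 r) (arc_length_ge0 r) (@arc_length_sigma_additive R r).

Definition vector_integral {R : realType}
    (mu : {measure set (R * R) -> \bar R}) (D : set (R * R)) : R * R :=
  (\int[mu]_(v in D) v.1, \int[mu]_(v in D) v.2).

Definition balance_law {R : realType} (Omega : set (R * R)) : Prop :=
  forall r : R, 0 <= r ->
    vector_integral (arc_length r) (circle r `&` Omega) = 0.

Definition conv_hull {R : realType} (A : set (R * R)) : set (R * R) :=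
  smallest (@convex_set R (R * R)%type) A.

Definition parallel {R : realType} (u v : R * R) : Prop :=
  u.1 * v.2 = u.2 * v.1.

Definition collinear {R : realType} (a b c : R * R) : Prop :=
  parallel (b - a) (c - a).

Definition triangle_with {R : realType} (a b c : R * R)
    (Omega : set (R * R)) : Prop :=
  ~ collinear a b c /\ Omega = conv_hull [set a; b; c].

Definition is_triangle {R : realType} (Omega : set (R * R)) : Prop :=
  exists a b c : R * R, triangle_with a b c Omega.

Definition is_centered_equilateral_triangle {R : realType}
    (Omega : set (R * R)) : Prop :=
  exists a b c : R * R,
    [/\ triangle_with a b c Omega,
        edist a b = edist b c, edist b c = edist c a
      & 3%:R^-1 *: (a + b + c) = 0].

(* Four points in convex position. This forces the quadrangle to have exactly
   four vertices: flat angles, and hence triangles, are excluded. The order of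
   the points is irrelevant. *)
Definition convex_quadrangle_with {R : realType} (a b c d : R * R)
    (Omega : set (R * R)) : Prop :=
  [/\ ~ conv_hull [set b; c; d] a, ~ conv_hull [set a; c; d] b,
      ~ conv_hull [set a; b; d] c, ~ conv_hull [set a; b; c] d
    & Omega = conv_hull [set a; b; c; d]].

Definition is_convex_quadrangle {R : realType} (Omega : set (R * R)) : Prop :=
  exists a b c d : R * R, convex_quadrangle_with a b c d Omega.

(* The two diagonals of a convex quadrangle cross, so the parallelism conditions
   force [a, b, c, d] to be in cyclic order, with diagonals [ac] and [bd]; the
   center is their common midpoint. *)
Definition is_centered_parallelogram {R : realType}
    (Omega : set (R * R)) : Prop :=
  exists a b c d : R * R,
    [/\ convex_quadrangle_with a b c d Omega,
        parallel (b - a) (c - d), parallel (c - b) (d - a),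
        2^-1 *: (a + c) = 0 & 2^-1 *: (b + d) = 0].

(* Main.v *)
(* The balance law at radius r says that the linear forms w.v have integral 0
   over the part of the circle of radius r inside Omega, equivalently over the
   part outside Omega. Nothing is integrated explicitly: a contradiction comes
   from a combination of such integrals, transported by reflections, whose
   integrand is nonnegative and positive somewhere.

   The origin is interior, since otherwise Omega lies in a half-plane. Let h be
   the least distance from the origin to the lines of the sides. For r slightly
   above h the outside of Omega on the circle is a disjoint union of caps of
   equal size centred at the unit normals of the nearest sides, so these normals
   sum to 0. For a triangle all three sides must be nearest, with normals at 120
   degrees. For a quadrangle the nearest sides either contain two opposite
   parallel ones, or are three sides of an equilateral triangle centred at 0
   truncated by the fourth; the latter is impossible because the triangle is
   balanced and the removed corner is not. In the former case Omega is the strip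
   |y| <= h cut by two legs. The legs see the circles in the same way, so up to
   symmetry they agree: Omega is a centred parallelogram or an isosceles
   trapezoid, and the trapezoid is heavier on the side of its long base. *)

Require Import Defs.
From mathcomp Require Import all_boot all_order all_algebra.
From mathcomp Require Import all_classical all_reals all_analysis.
From mathcomp Require Import measurable_realfun ring lra.

Set Implicit Arguments.
Unset Strict Implicit.
Unset Printing Implicit Defensive.

Import Order.TTheory GRing.Theory Num.Theory.
Import numFieldNormedType.Exports.

Local Open Scope classical_set_scope.
Local Open Scope ring_scope.

Definition dot {R : realType} (w v : R * R) : R := w.1 * v.1 + w.2 * v.2.

Definition cross {R : realType} (u v : R * R) : R := u.1 * v.2 - u.2 * v.1.

Definition unit_vector {R : realType} (n : R * R) := dot n n = 1.

(** * Integration over circles *)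

Section flip_integral.
Context {R : realType}.
Notation mu := (@lebesgue_measure R).
Implicit Types (t s : R) (f : R -> R).

Let measurable_flip t : measurable_fun [set: R] (fun s : R => t - s).
Proof. exact: measurable_funB. Qed.

(** By uniqueness of Lebesgue measure: its image under the flip gives every half-open interval the
    right length. *)
Lemma lebesgue_measure_flip t (A : set R) : measurable A ->
  mu [set s | A (t - s)] = mu A.
Proof.
move=> mA; apply/esym.
have mf := measurable_flip t.
have := @lebesgue_measure_unique R (pushforward mu
  ((fun s : R => t - s) : measurableTypeR R -> measurableTypeR R)).
apply=> // _ [[a b] _ <-].
(* The flip exchanges the open and the closed end, which does not affect the length. *)
have E : (fun s : R => t - s) @^-1` `]a, b] = `[t - b, t - a[%classic.
  by apply/seteqP; split => s /=; rewrite !in_itv /= => /andP[? ?]; apply/andP; split; lra.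
transitivity (mu `[t - b, t - a[%classic); last exact: (congr1 mu (esym E)).
rewrite !lebesgue_measure_itv /= !lte_fin.
have -> : (t - b < t - a) = (a < b) by apply/idP/idP => ?; lra.
by case: ifP => // _; rewrite -!EFinB; congr EFin; lra.
Qed.

Lemma Rintegral_flip t (i : interval R) f :
  measurable_fun [set: R] f ->
  mu.-integrable [set` i] (EFin \o (fun s => f (t - s))) ->
  (forall s, (t - s \in i) = (s \in i)) ->
  \int[mu]_(s in [set` i]) f (t - s) = \int[mu]_(s in [set` i]) f s.
Proof.
move=> mf intf ti; have mflip := measurable_flip t.
have Ei : (fun s : R => t - s) @^-1` [set` i] = [set` i].
  by apply/seteqP; split => s /=; rewrite ti.
pose nu : {measure set (measurableTypeR R) -> \bar R} :=
  pushforward mu ((fun s => t - s) : measurableTypeR R -> measurableTypeR R).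
rewrite /Rintegral; congr fine; apply/esym.
transitivity (\int[nu mflip]_(s in [set` i]) (f s)%:E)%E.
  apply: eq_measure_integral => A mA _.
  exact/esym/(lebesgue_measure_flip t mA).
rewrite /nu integral_pushforward //.
- by rewrite Ei.
- exact/measurable_EFinP.
- by rewrite Ei.
Qed.

End flip_integral.

(** Written over the parameter, so that Lebesgue measure on the line applies directly;
    [Rintegral_arc_length] gives the link with [arc_length]. *)
Definition circle_integral {R : realType} (r : R) (f : R * R -> R) : R :=
  \int[@lebesgue_measure R]_(s in `[0, 2 * pi * r[) f (circle_param r s).

Definition circle_integrable {R : realType} (r : R) (f : R * R -> R) :=
  measurable_fun [set: R * R] f /\
  exists M : R, forall s, `|f (circle_param r s)| <= M.

Section circle_integral.
Context {R : realType}.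
Notation mu := (@lebesgue_measure R).
Implicit Types (r s t : R) (f g : R * R -> R) (v w : R * R).

Lemma circle_paramP r s : 0 < r ->
  (circle_param r s).1 ^+ 2 + (circle_param r s).2 ^+ 2 = r ^+ 2.
Proof.
by move=> r0; rewrite /circle_param /= !exprMn -mulrDr cos2Dsin2 mulr1.
Qed.

(** Polar angle: the arccosine covers the upper half circle, and [2 * pi - acos x] the lower one. *)
Lemma unit_vectorP (x y : R) : x ^+ 2 + y ^+ 2 = 1 ->
  exists2 t : R, 0 <= t < 2 * pi & x = cos t /\ y = sin t.
Proof.
move=> xy1.
have x1 : -1 <= x <= 1 by apply/andP; split; nra.
have ax := acos_ge0 x1; have axpi := acos_lepi x1.
have cx : cos (acos x) = x by apply: acosK; rewrite in_itv.
have sx : sin (acos x) = `|y|.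
  by rewrite sin_acos // -sqrtr_sqr; congr Num.sqrt; lra.
have pi0 := @pi_gt0 R.
have [y0|y0] := leP 0 y.
  exists (acos x); first by apply/andP; split; lra.
  by rewrite cx sx ger0_norm.
(* Strictness keeps the angle [2 * pi - acos x] below [2 * pi]. *)
have ax0 : 0 < acos x.
  rewrite lt_neqAle ax andbT; apply/eqP => a0; move: sx.
  by rewrite -a0 sin0 ltr0_norm //; lra.
exists (2 * pi - acos x); first by apply/andP; split; lra.
rewrite cosB sinB mulr_natl cos2pi sin2pi cx sx ltr0_norm //.
by split; lra.
Qed.

Lemma circle_param_surj r v : 0 < r -> v.1 ^+ 2 + v.2 ^+ 2 = r ^+ 2 ->
  exists2 s, 0 <= s < 2 * pi * r & circle_param r s = v.
Proof.
move=> r0 vr; have rN0 : r != 0 by lra.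
have [|t /andP[t0 t2] [tx ty]] := @unit_vectorP (v.1 / r) (v.2 / r).
  by rewrite !expr_div_n -mulrDl vr divff // expf_neq0.
exists (t * r).
  by rewrite mulr_ge0 ?(ltW r0) //= ltr_pM2r.
by rewrite /circle_param mulfK // -tx -ty !(mulrC r) !divfK //; case: v {vr tx ty}.
Qed.

Lemma circle_param_periodic r s : 0 < r ->
  circle_param r (s + 2 * pi * r) = circle_param r s.
Proof.
move=> r0; rewrite /circle_param mulrDl mulfK ?gt_eqF //.
by rewrite mulr_natl cosD2pi sinD2pi.
Qed.

Lemma measurable_circle_comp r f : measurable_fun [set: R * R] f ->
  measurable_fun [set: R] (f \o circle_param r).
Proof. by move=> mf; exact: measurableT_comp mf (measurable_circle_param r). Qed.

Lemma bounded_integrable_itv (h : R -> R) (M : R) (i : interval R) :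
  measurable_fun [set: R] h -> (forall s, `|h s| <= M) ->
  (mu [set` i] < +oo)%E -> mu.-integrable [set` i] (EFin \o h).
Proof.
move=> mh hM ifin; apply: measurable_bounded_integrable => //.
  exact: measurable_funTS.
exists M; split; first exact: num_real.
by move=> x Mx s _ /=; rewrite (le_trans (hM s)) // ltW.
Qed.

Let arc_fin r : (mu `[0%R, (2 * pi * r)%R[%classic < +oo)%E.
Proof. by rewrite lebesgue_measure_itv /=; case: ifP => // _; rewrite ltry. Qed.

Let integrable_arc r f : circle_integrable r f ->
  mu.-integrable `[0, 2 * pi * r[ (EFin \o (f \o circle_param r)).
Proof.
move=> [mf [M fM]]; apply: (@bounded_integrable_itv _ M) => //.
exact: measurable_circle_comp.
Qed.

Lemma circle_integrableD r f g : circle_integrable r f ->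
  circle_integrable r g -> circle_integrable r (f \+ g).
Proof.
move=> [mf [M fM]] [mg [N gN]]; split; first exact: measurable_funD.
by exists (M + N) => s; rewrite (le_trans (ler_normD _ _)) // lerD.
Qed.

Lemma circle_integrableZ r f (a : R) : circle_integrable r f ->
  circle_integrable r (fun v => a * f v).
Proof.
move=> [mf [M fM]]; split; first exact: measurable_funM.
by exists (`|a| * M) => s; rewrite normrM ler_wpM2l.
Qed.

Lemma circle_integralD r f g : circle_integrable r f ->
  circle_integrable r g ->
  circle_integral r (f \+ g) = circle_integral r f + circle_integral r g.
Proof. by move=> fi gi; rewrite /circle_integral RintegralD //; exact: integrable_arc. Qed.

Lemma circle_integralZ r f (a : R) : circle_integrable r f ->
  circle_integral r (fun v => a * f v) = a * circle_integral r f.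
Proof. by move=> fi; rewrite /circle_integral RintegralZl //; exact: integrable_arc. Qed.

Lemma eq_circle_integral r f g : 0 < r ->
  (forall v, v.1 ^+ 2 + v.2 ^+ 2 = r ^+ 2 -> f v = g v) ->
  circle_integral r f = circle_integral r g.
Proof.
by move=> r0 fg; apply: eq_Rintegral => s _; apply: fg; rewrite circle_paramP.
Qed.

(** A nonnegative function with zero integral vanishes almost everywhere, whereas continuity of the
    parametrization makes [f] positive on a whole interval of parameters. *)
Lemma circle_integral_gt0 r f v : 0 < r -> circle_integrable r f ->
  (forall w, w.1 ^+ 2 + w.2 ^+ 2 = r ^+ 2 -> 0 <= f w) ->
  v.1 ^+ 2 + v.2 ^+ 2 = r ^+ 2 -> (\forall w \near v, 0 < f w) ->
  0 < circle_integral r f.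
Proof.
move=> r0 fi f0 vr fv.
have f0' s : 0 <= f (circle_param r s) by apply: f0; rewrite circle_paramP.
rewrite lt_neqAle Rintegral_ge0 ?andbT; last by move=> s _.
have [s0 /andP[s00 s0P] s0v] := circle_param_surj r0 vr.
apply/negP => /eqP If0.
have intf := integrable_arc fi.
have ae0 : ae_eq mu `[0%R, (2 * pi * r)%R[%classic (EFin \o (f \o circle_param r)) (cst 0%E).
  apply/ae_eq_integral_abs => //.
    by move/integrableP: intf => [].
  transitivity (\int[mu]_(s in `[0%R, (2 * pi * r)%R[%classic) (f (circle_param r s))%:E)%E.
    by apply: eq_integral => s _ /=; rewrite ger0_norm.
  apply/eqP; rewrite -[X in X == _]fineK; last exact: integrable_fin_num intf.
  by rewrite eqe; apply/eqP/esym.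
have cp : {for s0, continuous (circle_param r)}.
  have cd : (fun s : R => s / r) @ s0 --> s0 / r by apply: cvgM => //; exact: cvg_cst.
  apply: (@cvg_pair _ _ _ (nbhs s0) (nbhs (r * cos (s0 / r))) (nbhs (r * sin (s0 / r)))
    _ _ _ (fun s => r * cos (s / r)) (fun s => r * sin (s / r))) => /=.
    apply: cvgM; first exact: cvg_cst.
    exact: cvg_comp cd (@continuous_cos R _).
  apply: cvgM; first exact: cvg_cst.
  exact: cvg_comp cd (@continuous_sin R _).
move: fv; rewrite -s0v => /cp /nbhs_ballP[e /= e0 ball_e].
(* The interval extends to the right of [s0] only, since [s0] may be 0; the second bound keeps it
   inside the parameter range. *)
pose d := Num.min e (2 * pi * r - s0).
have d0 : 0 < d by rewrite lt_min e0 /= subr_gt0.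
have de : d <= e by rewrite ge_min lexx.
have dP : d <= 2 * pi * r - s0 by rewrite ge_min lexx orbT.
case: ae0 => N [mN N0 sub].
have : (mu `[s0, (s0 + d)%R[%classic <= mu N)%E.
  apply: le_measure; rewrite ?inE //.
  move=> s /=; rewrite in_itv /= => /andP[s0s sd]; apply: sub => /= h.
  have : s \in `[0, 2 * pi * r[.
    by rewrite in_itv /=; apply/andP; split; lra.
  move=> /h [fs0].
  have /ball_e : ball s0 e s.
    by rewrite /ball /= ltr_norml; apply/andP; split; lra.
  by rewrite /= fs0 ltxx.
rewrite N0 lebesgue_measure_itv /= lte_fin ltrDl d0 -EFinB lee_fin; lra.
Qed.

(* The interval [0, P[, P = 2 pi r, is split into [0, t] and ]t, P[; the maps
   s |-> t - s and s |-> t + P - s preserve these pieces. *)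
Lemma circle_integral_flip r t f : 0 < r -> 0 <= t < 2 * pi * r ->
  circle_integrable r f ->
  \int[mu]_(s in `[0, 2 * pi * r[) f (circle_param r (t - s)) =
  circle_integral r f.
Proof.
move=> r0 /andP[t0 tP] fi; set P := 2 * pi * r in tP *.
have mu_fin (i : interval R) : [set` i] `<=` `[0, P[ -> (mu [set` i] < +oo)%E.
  move=> iP; apply: le_lt_trans (arc_fin r).
  by apply: le_measure => //; rewrite inE.
have E : `[0, P[%classic = `[0, t]%classic `|` `]t, P[%classic :> set R.
  apply/seteqP; split => s /=; rewrite !in_itv /=.
    by move=> /andP[s0 sP]; have [st|st] := leP s t; [left|right]; rewrite ?s0.
  by move=> [|] /andP[? ?]; apply/andP; split; lra.
have s1 : `[0, t]%classic `<=` `[0, P[%classic by rewrite E; exact: subsetUl.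
have s2 : `]t, P[%classic `<=` `[0, P[%classic by rewrite E; exact: subsetUr.
have disj : [disjoint `[0, t]%classic & `]t, P[%classic].
  apply/eqP/seteqP; split => s //=; rewrite !in_itv /= => -[/andP[? ?] /andP[? ?]].
  lra.
have [mf [M fM]] := fi.
have mh c : measurable_fun [set: R] (fun s => f (circle_param r (c - s))).
  exact: measurableT_comp (measurable_circle_comp r mf) (measurable_funB _ _).
have inth c (i : interval R) : [set` i] `<=` `[0, P[ ->
    mu.-integrable [set` i] (EFin \o (fun s => f (circle_param r (c - s)))).
  by move=> iP; apply: (@bounded_integrable_itv _ M) => //; exact: mu_fin.
rewrite /circle_integral -/P E !Rintegral_setU //=; last 2 first.
- by rewrite -E; exact: integrable_arc.
- by rewrite -E; exact: inth.
congr (_ + _).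
  apply: (@Rintegral_flip _ t `[0, t] (f \o circle_param r)).
  + exact: measurable_circle_comp.
  + exact: inth.
  + by move=> s; rewrite !in_itv /=; apply/andP/andP => -[? ?]; split; lra.
rewrite -(@Rintegral_flip _ (t + P) `]t, P[ (f \o circle_param r)) /=.
+ apply: eq_Rintegral => s _; congr f.
  by rewrite addrAC circle_param_periodic.
+ exact: measurable_circle_comp.
+ exact: inth.
+ by move=> s; rewrite !in_itv /=; apply/andP/andP => -[? ?]; split; lra.
Qed.

(** In complex notation this is the product of [a] with the conjugate of [v]. For a unit vector [a]
    it is the reflection across the line at half the angle of [a]. *)
Definition reflection (a : R * R) (v : R * R) : R * R :=
  (a.1 * v.1 + a.2 * v.2, a.2 * v.1 - a.1 * v.2).

(** If [a] has angle [t], the reflection acts on the parameter as the flip [s |-> t * r - s]. *)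
Lemma circle_integral_reflection r f (a : R * R) : 0 < r ->
  unit_vector a -> circle_integrable r f ->
  circle_integral r (f \o reflection a) = circle_integral r f.
Proof.
move=> r0 /unit_vectorP[t /andP[t0 t2] [a1 a2]] fi.
have tr : 0 <= t * r < 2 * pi * r.
  by rewrite mulr_ge0 ?(ltW r0) //= ltr_pM2r.
rewrite -(circle_integral_flip r0 tr fi).
apply: eq_Rintegral => s _ /=; congr f.
rewrite /circle_param /reflection /= mulrBl mulfK ?gt_eqF // cosB sinB a1 a2.
by congr pair; ring.
Qed.

End circle_integral.

(** The balance law tested against all linear forms at positive radii; this version is stable under
    reflections and changes of basis. *)
Definition balanced {R : realType} (A : set (R * R)) :=
  measurable A /\
  forall r w, 0 < r -> circle_integral r (fun v => \1_A v * dot w v) = 0.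

(** * From the balance law to moments of linear forms *)

Section balanced.
Context {R : realType}.
Notation mu := (@lebesgue_measure R).
Implicit Types (r : R) (v w : R * R) (A : set (R * R)).

Lemma enorm_circle_param r s : 0 < r -> enorm (circle_param r s) = r.
Proof. by move=> r0; rewrite /enorm circle_paramP // sqrtr_sqr gtr0_norm. Qed.

Lemma measurable_circle r : 0 < r -> measurable (circle r).
Proof.
move=> r0.
pose g (v : R * R) := v.1 ^+ 2 + v.2 ^+ 2.
have mg : measurable_fun setT g.
  by apply: measurable_funD; exact: measurable_funX.
have -> : circle r = setT `&` g @^-1` [set r ^+ 2].
  apply/seteqP; split => v /=; rewrite /circle /= /enorm -/(g v).
    by move=> <-; rewrite sqr_sqrtr // addr_ge0 // sqr_ge0.
  by move=> [_ ->]; rewrite sqrtr_sqr gtr0_norm.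
exact: mg.
Qed.

Lemma circle_integrable_indic r w A : measurable A ->
  circle_integrable r (fun v => \1_A v * dot w v).
Proof.
move=> mA; split.
  apply: measurable_funM; first exact: measurable_indic.
  by apply: measurable_funD; exact: measurable_funM.
exists (`|w.1| * `|r| + `|w.2| * `|r|) => s.
rewrite normrM -[leRHS]mul1r ler_pM //.
  by rewrite indicE; case: (_ \in _); rewrite /= ?normr1 ?normr0.
rewrite (le_trans (ler_normD _ _)) // lerD // normrM ler_wpM2l //= normrM.
  by rewrite ler_piMr // ler_norml cos_geN1 cos_le1.
by rewrite ler_piMr // ler_norml sin_geN1 sin_le1.
Qed.

(** Change of variables for the image measure. The domain becomes an indicator, so that different
    sets can be compared under one integral sign. *)
Lemma Rintegral_arc_length r A (f : R * R -> R) : 0 < r -> measurable A ->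
  circle_integrable r f ->
  \int[arc_length r]_(v in circle r `&` A) f v =
  circle_integral r (fun v => \1_A v * f v).
Proof.
move=> r0 mA [mf [M fM]].
have mp : measurable_fun [set: measurableTypeR R] (circle_param r) :=
  measurable_circle_param r.
have mD : measurable (circle r `&` A) by apply: measurableI => //; exact: measurable_circle.
set I := measurable_itv `[0, 2 * pi * r[.
have mpD : measurable (circle_param r @^-1` (circle r `&` A)).
  by rewrite -[X in measurable X]setTI; exact: mp.
have fmp : measurable_fun [set: measurableTypeR R] (f \o circle_param r).
  exact: measurable_circle_comp.
set D := circle_param r @^-1` (circle r `&` A) in mpD *.
have fi : (mrestr mu I).-integrable D (EFin \o (f \o circle_param r)).
  apply: measurable_bounded_integrable => //.
  - apply: (@le_lt_trans _ _ (mu `[0, 2 * pi * r[%classic)).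
      rewrite /mrestr; apply: le_measure; rewrite ?inE //; first exact: measurableI.
    by rewrite lebesgue_measure_itv /=; case: ifP => // _; rewrite ltry.
  - exact: measurable_funTS.
  - exists M; split; first exact: num_real.
    by move=> x Mx s _ /=; rewrite (le_trans (fM s)) // ltW.
rewrite /Rintegral /circle_integral; congr fine.
transitivity (\int[pushforward (mrestr mu I) (circle_param r)]_(v in circle r `&` A) (f v)%:E)%E.
  by [].
rewrite (integral_pushforward mp _ fi) //; last exact/measurable_EFinP.
rewrite -/D.
have mJ : measurable (~` `[0, 2 * pi * r[%classic : set (measurableTypeR R)).
  exact: measurableC.
(* The restricted measure does not charge the complement of the parameter interval, which is
   therefore removed; on the rest it coincides with Lebesgue measure. *)
apply: etrans (negligible_integral mJ mpD fi _) _; first by rewrite /= /mrestr setICl measure0.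
rewrite setDE setCK (eq_measure_integral mu); last first.
  by move=> B mB BD; rewrite /= /mrestr setIidl // => x /BD[].
rewrite setIC integral_mkcondr; apply: eq_integral => s _.
rewrite /patch indicE /=.
have -> : (s \in D) = (circle_param r s \in A).
  apply/idP/idP; rewrite !inE; first by case.
  by split => //; exact: enorm_circle_param.
by case: (_ \in A); rewrite /= ?mul1r ?mul0r.
Qed.

Lemma balance_law_balanced A : measurable A -> balance_law A -> balanced A.
Proof.
move=> mA bA; split => // r w r0.
have E := bA r (ltW r0).
move: (congr1 fst E) (congr1 snd E); rewrite /vector_integral /=.
have fst_int : circle_integrable r (fun v : R * R => v.1).
  split; first exact: measurable_fst.
  exists `|r| => s; rewrite normrM ler_piMr //.
  by rewrite ler_norml cos_geN1 cos_le1.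
have snd_int : circle_integrable r (fun v : R * R => v.2).
  split; first exact: measurable_snd.
  exists `|r| => s; rewrite normrM ler_piMr //.
  by rewrite ler_norml sin_geN1 sin_le1.
rewrite !Rintegral_arc_length // => E1 E2 {E}.
have i1 := circle_integrable_indic r (1, 0) mA.
have i2 := circle_integrable_indic r (0, 1) mA.
transitivity (circle_integral r
  ((fun v => w.1 * (\1_A v * dot (1, 0) v)) \+ (fun v => w.2 * (\1_A v * dot (0, 1) v)))).
  by congr circle_integral; apply/funext => v; rewrite /dot /=; ring.
rewrite circle_integralD ?circle_integralZ //; try exact: circle_integrableZ.
have -> : (fun v => \1_A v * dot (1, 0) v) = (fun v : R * R => \1_A v * v.1).
  by apply/funext => v; rewrite /dot /=; ring.
have -> : (fun v => \1_A v * dot (0, 1) v) = (fun v : R * R => \1_A v * v.2).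
  by apply/funext => v; rewrite /dot /=; ring.
by rewrite E1 E2 !mulr0 addr0.
Qed.
End balanced.

(** * Balanced sets and polygons *)

Definition polygon {R : realType} {I : Type} (n : I -> R * R) (d : I -> R) :=
  [set v : R * R | forall i, dot (n i) v <= d i].

Section symmetry.
Context {R : realType}.
Implicit Types (r c h : R) (n v w a : R * R) (A : set (R * R)).

Lemma reflectionK a : unit_vector a -> involutive (reflection a).
Proof.
rewrite /unit_vector /dot => a1 [x y]; rewrite /reflection /=.
by congr pair; rewrite -[RHS]mul1r -a1; ring.
Qed.

Lemma dot_reflection a v w : unit_vector a ->
  dot (reflection a v) (reflection a w) = dot v w.
Proof.
by rewrite /unit_vector /dot /reflection /= => a1; rewrite -[RHS]mul1r -a1; ring.
Qed.

Lemma measurable_reflection a A : measurable A ->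
  measurable (reflection a @^-1` A).
Proof.
move=> mA; rewrite -[X in measurable X]setTI.
suff mr : measurable_fun setT (reflection a) by exact: mr.
apply: measurable_fun_pair.
- by apply: measurable_funD; exact: measurable_funM.
- by apply: measurable_funB; exact: measurable_funM.
Qed.

(** The reflection is an isometric involution, so a change of variables moves it from the set to the
    linear form. *)
Lemma circle_integral_indic_reflection r a w A : 0 < r -> unit_vector a ->
  measurable A ->
  circle_integral r (fun v => \1_(reflection a @^-1` A) v * dot w v) =
  circle_integral r (fun v => \1_A v * dot (reflection a w) v).
Proof.
move=> r0 a1 mA.
rewrite -[RHS](circle_integral_reflection r0 a1); last exact: circle_integrable_indic.
by congr circle_integral; apply/funext => v; rewrite /= dot_reflection // !indicE !mem_setE.
Qed.

Lemma balanced_reflection a A : unit_vector a -> balanced A ->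
  balanced (reflection a @^-1` A).
Proof.
move=> a1 [mA bA]; split; first exact: measurable_reflection.
by move=> r w r0; rewrite circle_integral_indic_reflection // bA.
Qed.

Lemma circle_integralN r A w : measurable A ->
  circle_integral r (fun v => \1_A v * dot (- w) v) =
  - circle_integral r (fun v => \1_A v * dot w v).
Proof.
move=> mA; rewrite -[RHS]mulN1r -circle_integralZ; last exact: circle_integrable_indic.
by congr circle_integral; apply/funext => v; rewrite /dot /=; ring.
Qed.

(** The moment equals its own opposite. *)
Lemma balanced_symmetric a w A r : 0 < r -> unit_vector a -> measurable A ->
  reflection a @^-1` A = A -> reflection a w = - w ->
  circle_integral r (fun v => \1_A v * dot w v) = 0.
Proof.
move=> r0 a1 mA Aa wa.
have := circle_integral_indic_reflection w r0 a1 mA.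
by rewrite Aa wa circle_integralN // => ?; lra.
Qed.

Lemma circle_integral_dotD r A w w' : measurable A ->
  circle_integral r (fun v => \1_A v * dot (w + w') v) =
  circle_integral r (fun v => \1_A v * dot w v) +
  circle_integral r (fun v => \1_A v * dot w' v).
Proof.
move=> mA; rewrite -circle_integralD; try exact: circle_integrable_indic.
by congr circle_integral; apply/funext => v; rewrite /dot /=; ring.
Qed.

Lemma circle_integral_dotZ r A w c : measurable A ->
  circle_integral r (fun v => \1_A v * dot (c *: w) v) =
  c * circle_integral r (fun v => \1_A v * dot w v).
Proof.
move=> mA; rewrite -circle_integralZ; last exact: circle_integrable_indic.
by congr circle_integral; apply/funext => v; rewrite /dot /= /GRing.scale /=; ring.
Qed.

(** Integrability is carried along in the induction, because additivity asks for it at each step. *)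
Lemma circle_integral_sum (I : finType) (P : pred I) r (f : I -> R * R -> R) :
  (forall i, circle_integrable r (f i)) ->
  circle_integrable r (fun v => \sum_(i | P i) f i v) /\
  circle_integral r (fun v => \sum_(i | P i) f i v) =
  \sum_(i | P i) circle_integral r (f i).
Proof.
move=> fi; elim: (index_enum I) => [|i s [IHi IH]].
  have -> : (fun v => \sum_(i <- [::] | P i) f i v) = cst 0.
    by apply/funext => v; rewrite big_nil.
  split; first by split=> //; exists 0 => s; rewrite normr0.
  rewrite big_nil /circle_integral Rintegral_cst //.
  by rewrite mul0r.
have [Pi|Pi] := boolP (P i); last first.
  rewrite big_cons (negbTE Pi) -IH.
  suff -> : (fun v => \sum_(j <- i :: s | P j) f j v) =
    (fun v => \sum_(j <- s | P j) f j v) by [].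
  by apply/funext => v; rewrite big_cons (negbTE Pi).
rewrite big_cons Pi -IH -circle_integralD //.
have -> : (fun v => \sum_(j <- i :: s | P j) f j v) =
    f i \+ (fun v => \sum_(j <- s | P j) f j v).
  by apply/funext => v; rewrite big_cons Pi.
by split=> //; exact: circle_integrableD.
Qed.

(** The map [w |-> - w] is a product of two reflections, both preserving the plane. *)
Lemma balanced_plane : balanced [set: R * R].
Proof.
split => // r w r0.
have u1 : unit_vector (1 : R, 0 : R) by rewrite /unit_vector /dot /=; ring.
have u2 : unit_vector (-1 : R, 0 : R) by rewrite /unit_vector /dot /=; ring.
have E := circle_integral_indic_reflection w r0 u1 measurableT.
have := circle_integral_indic_reflection (reflection (1, 0) w) r0 u2 measurableT.
rewrite !preimage_setT in E *; rewrite -E.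
have -> : reflection (-1, 0) (reflection (1, 0) w) = - w.
  by rewrite /reflection /=; case: w {E} => x y; congr pair; rewrite /=; ring.
by rewrite circle_integralN // => ?; lra.
Qed.

(** An open half-plane; only its trace on a circle is a cap. *)
Definition cap n h := [set v | h < dot n v].

Lemma measurable_dot n : measurable_fun setT (dot n).
Proof. by apply: measurable_funD; exact: measurable_funM. Qed.

Lemma measurable_cap n h : measurable (cap n h).
Proof.
have -> : cap n h = setT `&` dot n @^-1` [set` `]h, +oo[].
  by apply/seteqP; split => v /=; rewrite /cap /= in_itv /= andbT => // -[].
exact: measurable_dot.
Qed.

Lemma near_dot_lt n h v : dot n v < h -> \forall u \near v, dot n u < h.
Proof.
have dot_cvg : dot n u @[u --> v] --> dot n v.
  apply: cvgD; apply: cvgM; (try exact: cvg_cst); [exact: cvg_fst|exact: cvg_snd].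
by move=> nv; exact: cvgr_lt dot_cvg _ nv.
Qed.

Lemma near_dot_gt n h v : h < dot n v -> \forall u \near v, h < dot n u.
Proof.
have E u : dot (- n) u = - dot n u by rewrite /dot /=; ring.
move=> nv; have : dot (- n) v < - h by rewrite E ltrN2.
by move/near_dot_lt; apply: filterS => u; rewrite E ltrN2.
Qed.

(** The moment of a cap points along its axis by symmetry, and its length [c] is the same for all
    axes, since reflections carry any cap to the one centred at [(1, 0)]. *)
Lemma cap_integral r h : 0 < h < r -> exists2 c, 0 < c &
  forall n w, unit_vector n ->
    circle_integral r (fun v => \1_(cap n h) v * dot w v) = c * dot n w.
Proof.
move=> /andP[h0 hr]; have r0 : 0 < r by lra.
pose e : R * R := (1, 0).
have u1 : unit_vector e by rewrite /unit_vector /dot /=; ring.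
have mc n := measurable_cap n h.
have ci n w : circle_integrable r (fun v => \1_(cap n h) v * dot w v).
  exact: circle_integrable_indic.
exists (circle_integral r (fun v => \1_(cap e h) v * dot e v)).
  apply: (circle_integral_gt0 (v := (r, 0)) r0) => //=; last 2 first.
  - by ring.
  - near=> v; have : h < dot e v by near: v; apply: near_dot_gt; rewrite /dot /=; lra.
    by move=> hv; rewrite indicE mem_set //= mul1r; lra.
  move=> w _; rewrite indicE; have [wc|] := boolP (w \in cap e h); last by rewrite mul0r.
  by move: wc; rewrite inE /cap /= mul1r => ?; lra.
move=> n w n1.
have -> : cap n h = reflection n @^-1` cap e h.
  apply/seteqP; split => v; rewrite /cap /=.
    by congr (_ < _); rewrite /dot /reflection /=; ring.
  by congr (_ < _); rewrite /dot /reflection /=; ring.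
rewrite circle_integral_indic_reflection //.
(* The second component contributes nothing: the cap is symmetric about the first axis. *)
have -> : reflection n w = dot n w *: e + (reflection n w).2 *: (0, 1).
  rewrite /reflection /dot /e /= /GRing.scale /=.
  by congr pair; rewrite /= /GRing.scale /=; ring.
rewrite circle_integral_dotD // !circle_integral_dotZ //.
rewrite [X in _ + _ * X](@balanced_symmetric e) ?mulr0 ?addr0 1?mulrC //.
- by apply/seteqP; split => v; rewrite /cap /= /dot /reflection /= => ?; lra.
- by rewrite /reflection /e /=; congr pair; rewrite /=; ring.
Unshelve. all: by end_near. Qed.

End symmetry.

(** * Polygons given by half-planes and their nearest sides *)

Section polygon.
Context {R : realType} {I : finType}.
Implicit Types (n : I -> R * R) (d : I -> R) (v w p : R * R).

Lemma near_polygon n d p : (forall i, dot (n i) p < d i) ->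
  \forall v \near p, polygon n d v.
Proof.
move=> np.
have : \forall v \near p, forall i, [set u | dot (n i) u < d i] v.
  apply: (@filter_forall _ I (fun i => [set u | dot (n i) u < d i]) (nbhs p) _).
  by move=> i; exact: (near_dot_lt (np i)).
by apply: filterS => v nv i; exact: ltW (nv i).
Qed.

Lemma dot_self_ge0 p : 0 <= dot p p.
Proof. by rewrite /dot -!expr2 addr_ge0 // sqr_ge0. Qed.

Lemma dot_self_eq0 p : dot p p = 0 -> p = 0.
Proof.
case: p => x y; rewrite /dot /= => pp.
have -> : x = 0 by apply/eqP; rewrite -sqrf_eq0 eq_le; apply/andP; split; nra.
have -> // : y = 0 by apply/eqP; rewrite -sqrf_eq0 eq_le; apply/andP; split; nra.
Qed.

Lemma dot_self_gt0 w p : dot w p != 0 -> 0 < dot p p.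
Proof.
move=> wp; rewrite lt_def dot_self_ge0 andbT; apply: contra wp => /eqP/dot_self_eq0 ->.
by rewrite /dot !mulr0 addr0.
Qed.

Lemma Cauchy_Schwarz v w : dot v w ^+ 2 <= dot v v * dot w w.
Proof.
have -> : dot v v * dot w w = dot v w ^+ 2 + (v.1 * w.2 - v.2 * w.1) ^+ 2.
  by rewrite /dot; ring.
by rewrite lerDl sqr_ge0.
Qed.

(** The squared length of [u - v] is [2 - 2 * dot u v]. *)
Lemma dot_unit_lt1 (u v : R * R) : unit_vector u -> unit_vector v -> u != v ->
  dot u v < 1.
Proof.
rewrite /unit_vector => u1 v1 uv.
have E : dot (u - v) (u - v) = dot u u + dot v v - 2 * dot u v by rewrite /dot /=; ring.
suff : 0 < dot (u - v) (u - v) by rewrite E u1 v1; lra.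
rewrite lt_def dot_self_ge0 andbT; apply: contra uv => /eqP/dot_self_eq0 /eqP.
by rewrite subr_eq0.
Qed.

(* Otherwise the polygon lies in a half-plane bounded by a line through the
   origin. *)
Lemma balanced_polygon_gt0 n d p : balanced (polygon n d) ->
  (forall i, dot (n i) p < d i) -> forall i, 0 < d i.
Proof.
move=> [mP bP] np i; rewrite ltNge; apply/negP => di.
have npi := np i.
have dN v : dot (- n i) v = - dot (n i) v by rewrite /dot /=; ring.
have p0 : 0 < dot p p by apply: (@dot_self_gt0 (n i)); lra.
pose r := Num.sqrt (dot p p); have r0 : 0 < r by rewrite sqrtr_gt0.
suff : 0 < circle_integral r (fun v => \1_(polygon n d) v * dot (- n i) v).
  by rewrite bP // ltxx.
apply: (@circle_integral_gt0 _ r _ p r0).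
- exact: circle_integrable_indic.
- move=> v _; rewrite indicE dN; have [|] := boolP (v \in polygon n d); last by rewrite mul0r.
  by rewrite inE => /(_ i) ?; rewrite mul1r; lra.
- by rewrite sqr_sqrtr ?(ltW p0) // /dot; ring.
- near=> v; rewrite indicE mem_set ?mul1r ?dN.
    suff : dot (n i) v < d i by move=> /= ?; lra.
    by near: v; exact: near_dot_lt.
  by near: v; exact: near_polygon.
Unshelve. all: by end_near. Qed.

Lemma dot_le (r : R) (n v : R * R) : 0 < r -> unit_vector n -> dot v v = r ^+ 2 ->
  dot n v <= r.
Proof.
rewrite /unit_vector => r0 n1 vr.
have := Cauchy_Schwarz n v; rewrite n1 vr mul1r => ?.
by rewrite leNgt; apply/negP => ?; nra.
Qed.

(* For r slightly larger than h = min d, the part of the circle outside the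
   polygon is the disjoint union of the caps over the sides at distance h. *)
Lemma nearest_normals n d i0 : injective n -> (forall i, unit_vector (n i)) ->
  (forall i, 0 < d i) -> (forall i, d i0 <= d i) -> balanced (polygon n d) ->
  \sum_(i | d i == d i0) n i = 0.
Proof.
move=> n_inj n1 d0 dmin [mP bP]; set h := d i0.
have h0 : 0 < h by exact: d0.
(* The last condition separates the caps: the squared length of [n i + n j] is
   [2 * (1 + dot (n i) (n j))], while a common point would give [2 * h < dot (n i + n j) v]. It is
   strict at [r = h] because distinct unit vectors have product below 1, so it persists slightly
   beyond [h]. *)
have [r [hr rd rc]] : exists r, [/\ h < r, (forall i, h < d i -> r < d i)
  & forall i j, i != j -> r ^+ 2 * (1 + dot (n i) (n j)) <= 2 * h ^+ 2].
  have near_d : \forall r \near h, forall i, [set s : R | h < d i -> s < d i] r.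
    apply: (@filter_forall _ I (fun i => [set s : R | h < d i -> s < d i]) (nbhs h) _) => i.
    have [hd|dh] := ltP h (d i); last by near=> s => /= ?; lra.
    have : \forall s \near h, s < d i.
      by apply: (@cvgr_lt _ _ (nbhs h) _ id h) hd; exact: cvg_id.
    by apply: filterS => s /=.
  have near_c : \forall r \near h, forall ij : I * I,
      [set s : R | ij.1 != ij.2 -> s * s * (1 + dot (n ij.1) (n ij.2)) < 2 * h ^+ 2] r.
    apply: (@filter_forall _ _ (fun ij : I * I => [set s : R | ij.1 != ij.2 ->
      s * s * (1 + dot (n ij.1) (n ij.2)) < 2 * h ^+ 2]) (nbhs h) _) => -[i j] /=.
    have [<-|ij] := eqVneq i j; first by near=> s.
    have c1 : dot (n i) (n j) < 1 by apply: dot_unit_lt1 => //; rewrite (inj_eq n_inj).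
    have cv : (s * s * (1 + dot (n i) (n j))) @[s --> h] --> h * h * (1 + dot (n i) (n j)).
      by apply: cvgM; [exact: cvgM|exact: cvg_cst].
    have : h * h * (1 + dot (n i) (n j)) < 2 * h ^+ 2 by have := mulr_gt0 h0 h0; nra.
    by move=> /(cvgr_lt _ cv); apply: filterS => s /=.
  have [e /= e0 he] := (nbhs_ballP _ _).1 (filterI near_d near_c).
  have /he[] : ball h e (h + e / 2).
    by rewrite /ball /= opprD addNKr normrN gtr0_norm; lra.
    move=> rd rc; exists (h + e / 2); split=> //; first lra.
    by move=> i j ij; rewrite expr2; apply: ltW; exact: (rc (i, j)).
have r0 : 0 < r by lra.
have [|c c0 capc] := @cap_integral R r h; first by rewrite h0.
have far i : h < d i -> forall v, v.1 ^+ 2 + v.2 ^+ 2 = r ^+ 2 -> dot (n i) v <= d i.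
  move=> hd v vr; apply: ltW; apply: le_lt_trans (rd i hd); exact: dot_le.
have disj i j v : i != j -> v.1 ^+ 2 + v.2 ^+ 2 = r ^+ 2 ->
    h < dot (n i) v -> dot (n j) v <= h.
  move=> ij vr hi; rewrite leNgt; apply/negP => hj.
  have := Cauchy_Schwarz (n i + n j) v.
  have -> : dot v v = r ^+ 2 by [].
  have -> : dot (n i + n j) v = dot (n i) v + dot (n j) v by rewrite /dot /=; ring.
  have -> : dot (n i + n j) (n i + n j) =
      dot (n i) (n i) + dot (n j) (n j) + 2 * dot (n i) (n j) by rewrite /dot /=; ring.
  have -> : dot (n i) (n i) = 1 by exact: n1.
  have -> : dot (n j) (n j) = 1 by exact: n1.
  by have := rc i j ij; nra.
(* Taking [w] to be the sum itself shows that the sum has length 0. *)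
suff nw w : c * dot (\sum_(i | d i == h) n i) w = 0.
  apply: dot_self_eq0; apply/eqP.
  by rewrite -(mulrI_eq0 _ (lregP (negbT (gt_eqF c0)))) nw.
have dot_sum : dot (\sum_(i | d i == h) n i) w = \sum_(i | d i == h) dot (n i) w.
  apply: (big_morph (fun u => dot u w)) => [u v|]; rewrite /dot /=; first by ring.
  by rewrite !mul0r addr0.
have [ic Ec] := @circle_integral_sum R I (fun i => d i == h) r
  (fun i v => \1_(cap (n i) h) v * dot w v)
  (fun i => circle_integrable_indic r w (measurable_cap (n i) h)).
transitivity (circle_integral r (fun v => \1_setT v * dot w v)); last first.
  by case: (@balanced_plane R) => _; exact.
(* On the circle the constant 1 is the indicator of the polygon plus those of the nearest caps. The
   plane and the polygon are balanced, hence so are the caps together. *)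
rewrite (@eq_circle_integral _ r _ ((fun v => \1_(polygon n d) v * dot w v) \+
  (fun v => \sum_(i | d i == h) \1_(cap (n i) h) v * dot w v))) //.
  rewrite circle_integralD //; last exact: circle_integrable_indic.
  rewrite bP // add0r Ec dot_sum mulr_sumr.
  by apply: eq_bigr => i _; rewrite capc.
move=> v vr /=; rewrite -mulr_suml -mulrDl; congr (_ * _).
rewrite indicE in_setT.
have [vP|vP] := boolP (v \in polygon n d).
  rewrite indicE vP big1 ?addr0 // => i /eqP di.
  rewrite indicE memNset // /cap /= => hi.
  by move: vP; rewrite inE => /(_ i); rewrite di leNgt hi.
rewrite indicE (negbTE vP) add0r.
have [i nvi] : exists i, d i < dot (n i) v.
  apply: contrapT => H; move/negP: vP; apply; rewrite inE => i.
  by rewrite leNgt; apply/negP => ?; apply: H; exists i.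
(* A violated side must be a nearest one, the others being out of reach at radius [r]. *)
have di : d i == h.
  rewrite eq_le dmin andbT leNgt; apply/negP => hd.
  by have := far _ hd _ vr; lra.
rewrite (bigD1 i) //= indicE mem_set /cap /=; last by rewrite -(eqP di).
rewrite big1 ?addr0 // => j /andP[/eqP dj ji].
rewrite indicE memNset // /cap /=; apply/negP; rewrite -leNgt.
by apply: (disj i j) => //; [rewrite eq_sym|rewrite -(eqP di)].
Unshelve. all: by end_near. Qed.

End polygon.

(** * Trapezoids *)

Section trapezoid.
Context {R : realType}.
Implicit Types (r h p q m k : R) (u v w a : R * R) (A B : set (R * R)).

Let e1 : R * R := (1, 0).
Let e2 : R * R := (0, 1).

Let unit_e1 : unit_vector e1. Proof. by rewrite /unit_vector /dot /e1 /=; ring. Qed.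
Let unit_Ne1 : unit_vector (- e1). Proof. by rewrite /unit_vector /dot /e1 /=; ring. Qed.

(** Comparison principle behind the contradictions below: on the circle through [u], the difference
    of the two integrands is nonnegative, and it is positive near [u]. *)
Lemma circle_integral_indic_lt A B w u : measurable A -> measurable B ->
  0 < dot u u ->
  (forall v, dot v v = dot u u -> A v -> ~ B v -> 0 <= dot w v) ->
  (forall v, dot v v = dot u u -> B v -> ~ A v -> dot w v <= 0) ->
  (\forall v \near u, [/\ A v, ~ B v & 0 < dot w v]) ->
  exists2 r, 0 < r &
    circle_integral r (fun v => \1_B v * dot w v) <
    circle_integral r (fun v => \1_A v * dot w v).
Proof.
move=> mA mB u0 AB BA ABp.
exists (Num.sqrt (dot u u)); first by rewrite sqrtr_gt0.
set r := Num.sqrt _; have r0 : 0 < r by rewrite sqrtr_gt0.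
have r2 : r ^+ 2 = dot u u by rewrite sqr_sqrtr ?ltW.
have iA := circle_integrable_indic r w mA.
have iB := circle_integrable_indic r w mB.
rewrite -subr_gt0 -mulN1r -circle_integralZ // -circle_integralD //;
  last exact: circle_integrableZ.
apply: (@circle_integral_gt0 _ r _ u r0).
- by apply: circle_integrableD => //; exact: circle_integrableZ.
- move=> v; rewrite r2 => vu /=.
  rewrite !indicE; have [|] := boolP (v \in A); rewrite ?inE => vA;
    have [|] := boolP (v \in B); rewrite ?inE => vB;
    rewrite ?mul1r ?mul0r ?mulr0 ?addr0 ?mulN1r ?add0r ?subrr //.
    by apply: AB => //; move/negP: vB; rewrite inE.
  by rewrite oppr_ge0; apply: BA => //; move/negP: vA; rewrite inE.
- by rewrite r2 /dot; ring.
- near=> v; have [Av Bv wv] : [/\ A v, ~ B v & 0 < dot w v] by near: v.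
  by rewrite /= !indicE mem_set // memNset // mul1r mul0r mulr0 addr0.
Unshelve. all: by end_near. Qed.

(** The part of the strip between the vertical axis and the slanted line [x = p + m * y]; [p] is the
    width at mid-height. *)
Definition leg h p m : set (R * R) :=
  [set v | [/\ - h <= v.2 <= h, 0 < v.1 & v.1 <= p + m * v.2]].

Lemma measurable_leg h p m : measurable (leg h p m).
Proof.
have -> : leg h p m = ~` cap e2 h `&` ~` cap (- e2) h `&` cap e1 0 `&` ~` cap (1, - m) p.
  apply/seteqP; split => v /=; rewrite /leg /cap /e1 /e2 /dot /=.
    move=> [/andP[? ?] ? ?]; split; [split; [split|]|]; try (apply/negP; rewrite -leNgt); lra.
  by move=> [[[/negP + /negP +] +] /negP]; rewrite -!leNgt => ? ? ? ?;
    split; [apply/andP; split|..]; lra.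
by do ?apply: measurableI; do ?apply: measurableC; exact: measurable_cap.
Qed.

Lemma near_leg h p m v : - h < v.2 < h -> 0 < v.1 -> v.1 < p + m * v.2 ->
  \forall u \near v, leg h p m u.
Proof.
move=> /andP[hv vh] v1 vp; near=> u.
have : dot e2 u < h by near: u; apply: near_dot_lt; rewrite /dot /e2 /=; lra.
have : - h < dot e2 u by near: u; apply: near_dot_gt; rewrite /dot /e2 /=; lra.
have : 0 < dot e1 u by near: u; apply: near_dot_gt; rewrite /dot /e1 /=; lra.
have : dot (1, - m) u < p by near: u; apply: near_dot_lt; rewrite /dot /=; lra.
rewrite /dot /e1 /e2 /= => ? ? ? ?; split; [apply/andP; split|..]; lra.
Unshelve. all: by end_near. Qed.

Lemma near_notin_leg h p m v : p + m * v.2 < v.1 ->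
  \forall u \near v, ~ leg h p m u.
Proof.
move=> vp; have : p < dot (1, - m) v by rewrite /dot /=; lra.
by move=> /near_dot_gt; apply: filterS => u; rewrite /dot /= => ? [_ _ ?]; lra.
Qed.

Definition leg_moment h p m r := circle_integral r (fun v => \1_(leg h p m) v * dot e1 v).

(* Otherwise some circle beyond the far end of the second leg still meets the
   first one. *)
Lemma leg_top_le h p m q k : 0 < h -> 0 <= m -> 0 <= k -> h * m < p -> h * k < q ->
  (forall r, 0 < r -> leg_moment h p m r = leg_moment h q k r) ->
  p + m * h <= q + k * h.
Proof.
move=> h0 m0 k0 mp kq E; rewrite leNgt; apply/negP => qp.
set P := p + m * h in qp; set Q := q + k * h in qp.
have Q0 : 0 < Q by rewrite /Q; nra.
pose a := (P + Q) / 2; have Qa : Q < a by rewrite /a; lra.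
(* The three bounds keep the point [u] below inside the strip, inside the first leg, and farther
   from the origin than the corner [(Q, h)]. The denominator [m + 1] allows [m = 0]. *)
pose eps := Num.min (h / 2) (Num.min ((P - Q) / 2 / (m + 1)) ((a ^+ 2 - Q ^+ 2) / (4 * h))).
have [eps0 epsh epsm epsa] : [/\ 0 < eps, eps <= h / 2, m * eps < (P - Q) / 2 &
    4 * h * eps <= a ^+ 2 - Q ^+ 2].
  have aQ : 0 < a ^+ 2 - Q ^+ 2 by nra.
  have x0 : 0 < (P - Q) / 2 / (m + 1) by rewrite divr_gt0; lra.
  have y0 : 0 < (a ^+ 2 - Q ^+ 2) / (4 * h) by rewrite divr_gt0 // mulr_gt0.
  have eps0 : 0 < eps by rewrite !lt_min x0 y0 divr_gt0.
  have epsh : eps <= h / 2 by rewrite ge_min lexx.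
  have : eps <= (P - Q) / 2 / (m + 1) by rewrite !ge_min lexx orbT.
  rewrite ler_pdivlMr ?ltr_wpDl // => epsm.
  have : eps <= (a ^+ 2 - Q ^+ 2) / (4 * h) by rewrite !ge_min lexx !orbT.
  rewrite ler_pdivlMr ?mulr_gt0 // => epsa.
  by split=> //; nra.
pose u : R * R := (a, h - eps).
have uu : dot u u > Q ^+ 2 + h ^+ 2 by rewrite /dot /u /=; nra.
have u0 : 0 < dot u u by have := sqr_ge0 Q; have := sqr_ge0 h; lra.
(* The farthest points of the second leg are at squared distance at most [Q ^+ 2 + h ^+ 2], reached
   at its top corner since [k] is nonnegative. *)
have far v : dot v v = dot u u -> ~ leg h q k v.
  move=> vu [/andP[v2 v2'] v1 v1q].
  have : dot v v <= Q ^+ 2 + h ^+ 2; last by rewrite vu; lra.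
  have vQ : v.1 <= Q by rewrite /Q; nra.
  by rewrite /dot -!expr2; nra.
have [|||r r0] :=
  circle_integral_indic_lt (w := e1) (measurable_leg h p m) (measurable_leg h q k) u0.
- by move=> v _ [_ v1 _] _; rewrite /dot /e1 /=; lra.
- by move=> v vu /far.
- near=> v; split.
  + near: v; apply: near_leg; rewrite /u /=; [apply/andP; split|..]; try lra.
    by rewrite /a; rewrite /P in epsm *; nra.
  + near: v; apply: near_notin_leg; rewrite /u /=; rewrite /Q in Qa; nra.
  + near: v; apply: near_dot_gt; rewrite /dot /e1 /u /=; lra.
- by rewrite -/(leg_moment _ _ _ _) -/(leg_moment _ _ _ _) E // ltxx.
Unshelve. all: by end_near. Qed.

(* Otherwise the second leg is strictly contained in the first one. *)
Lemma leg_slope_ge h p m q k : 0 < h -> h * m < p -> h * k < q ->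
  0 <= m -> 0 <= k -> p + m * h = q + k * h ->
  (forall r, 0 < r -> leg_moment h p m r = leg_moment h q k r) ->
  k <= m.
Proof.
move=> h0 mp kq m0 k0 PQ E; rewrite leNgt; apply/negP => mk.
have qp : q < p by nra.
(* Equal top widths and [m < k] give [q < p], so this point of the horizontal axis separates the
   legs. *)
pose u : R * R := ((p + q) / 2, 0).
have q0 : 0 < q by nra.
have u0 : 0 < dot u u by rewrite /dot /u /=; nra.
have [|v _||r r0] :=
  circle_integral_indic_lt (w := e1) (measurable_leg h p m) (measurable_leg h q k) u0.
- by move=> v _ [_ v1 _] _; rewrite /dot /e1 /=; lra.
- move=> [/andP[v2 v2'] v1 v1q]; case; split; [by apply/andP|by []|nra].
- near=> v; split.
  + near: v; apply: near_leg; rewrite /u /=; [apply/andP; split|..]; lra.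
  + near: v; apply: near_notin_leg; rewrite /u /=; lra.
  + near: v; apply: near_dot_gt; rewrite /dot /e1 /u /=; lra.
- by rewrite -/(leg_moment _ _ _ _) -/(leg_moment _ _ _ _) E // ltxx.
Unshelve. all: by end_near. Qed.

(** The two preceding comparisons, each applied in both directions. *)
Lemma leg_inj h p m q k : 0 < h -> h * m < p -> h * k < q ->
  0 <= m -> 0 <= k ->
  (forall r, 0 < r -> leg_moment h p m r = leg_moment h q k r) ->
  p = q /\ m = k.
Proof.
move=> h0 mp kq m0 k0 E.
have E' r : 0 < r -> leg_moment h q k r = leg_moment h p m r by move=> /E.
have PQ : p + m * h = q + k * h.
  by apply/eqP; rewrite eq_le !leg_top_le.
have mk : m = k.
  by apply/eqP; rewrite eq_le (leg_slope_ge h0 kq mp) // (leg_slope_ge h0 mp kq).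
by split=> //; move: PQ; rewrite mk => /addIr.
Qed.

(** Reflection across the first axis keeps the horizontal component, so the sign of the slope is
    invisible to the moment; this allows nonnegative slopes to be assumed. *)
Lemma leg_moment_flip h p m r : 0 < r -> leg_moment h p (- m) r = leg_moment h p m r.
Proof.
move=> r0; have := circle_integral_indic_reflection e1 r0 unit_e1 (measurable_leg h p m).
have -> : reflection e1 e1 = e1 by rewrite /reflection /e1 /=; congr pair; ring.
rewrite /leg_moment => <-.
suff -> : leg h p (- m) = reflection e1 @^-1` leg h p m by [].
by apply/seteqP; split => v; rewrite /leg /reflection /e1 /= => -[/andP[? ?] ? ?];
  split; [apply/andP; split|..]; lra.
Qed.

Lemma leg_moment_norm h p m r : 0 < r -> leg_moment h p `|m| r = leg_moment h p m r.
Proof. by move=> r0; case: (ger0P m) => // _; rewrite leg_moment_flip. Qed.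

(** The widths on both sides of the vertical axis are [p + m * y] and [q + k * y]: equal slopes give
    an isosceles trapezoid when [p = q], opposite slopes a parallelogram. *)
Definition trapezoid h p m q k : set (R * R) :=
  [set v | [/\ - h <= v.2 <= h, v.1 <= p + m * v.2 & - v.1 <= q + k * v.2]].

(** Off the vertical axis the trapezoid is the disjoint union of one leg and the mirror image of the
    other, whose horizontal moments must cancel. *)
Lemma balanced_trapezoid_leg h p m q k r : 0 < r -> h * `|m| < p -> h * `|k| < q ->
  balanced (trapezoid h p m q k) -> leg_moment h p m r = leg_moment h q k r.
Proof.
move=> r0 mp kq [mT bT].
(* Each slanted side stays on its own side of the vertical axis, so on either half the opposite
   constraint is automatic. *)
have lpos p' m' y : h * `|m'| < p' -> - h <= y <= h -> 0 < p' + m' * y.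
  move=> mp' yh; have : `|m' * y| <= h * `|m'|.
    by rewrite normrM mulrC ler_wpM2r // ler_norml.
  by rewrite ler_norml => /andP[? _]; lra.
have := circle_integral_indic_reflection e1 r0 unit_Ne1 (measurable_leg h q k).
have -> : reflection (- e1) e1 = - e1 by rewrite /reflection /e1 /=; congr pair; rewrite /=; ring.
rewrite (circle_integralN r e1 (measurable_leg h q k)) -/(leg_moment h q k r) => E.
have mL' := measurable_reflection (- e1) (measurable_leg h q k).
have := bT r e1 r0.
rewrite (@eq_circle_integral _ r _ ((fun v => \1_(leg h p m) v * dot e1 v) \+
   (fun v => \1_(reflection (- e1) @^-1` leg h q k) v * dot e1 v)) r0).
  rewrite (circle_integralD (circle_integrable_indic r e1 (measurable_leg h p m))
    (circle_integrable_indic r e1 mL')) E.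
  by rewrite -/(leg_moment h p m r); lra.
move=> v _ /=; rewrite -mulrDl.
have -> : dot e1 v = v.1 by rewrite /dot /e1 /=; ring.
have [v0|v0|->] := ltgtP v.1 0; last by rewrite !mulr0.
- congr (_ * _).
  rewrite [X in _ = X + _]indicE memNset ?add0r; last by move=> [_ ? _]; lra.
  rewrite !indicE; congr ((_ : bool)%:R); apply/idP/idP; rewrite !inE.
    move=> [vh _ vq]; rewrite /leg /reflection /e1 /=.
    by split; [rewrite !(mulNr, mul0r, oppr0, mul1r, add0r, addr0)|..]; lra.
  rewrite /leg /reflection /e1 /= => -[/andP[? ?] ? ?].
  have vh : - h <= v.2 <= h by apply/andP; split; lra.
  by split=> //; have := lpos p m v.2 mp vh; lra.
- congr (_ * _).
  rewrite [X in _ = _ + X]indicE memNset ?addr0; last first.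
    by rewrite /reflection /e1 /= => -[_ /= ? _]; lra.
  rewrite !indicE; congr ((_ : bool)%:R); apply/idP/idP; rewrite !inE.
    by move=> [].
  by move=> [vh ? ?]; split=> //; have := lpos q k v.2 kq vh; lra.
Qed.

(** For [m > 0] the trapezoid is compared with its mirror image in the first axis: points gained are
    in the upper half, points lost in the lower half, yet both vertical moments vanish. *)
Lemma isosceles_balanced_le0 h p m : 0 < h -> h * `|m| < p ->
  balanced (trapezoid h p m p m) -> m <= 0.
Proof.
move=> h0 mp [mT bT]; rewrite leNgt; apply/negP => m0.
have p0 : 0 < p by rewrite gtr0_norm // in mp; nra.
(* At height [h / 2] the abscissa [p] lies strictly between the half-widths [p - m * h / 2] of the
   mirror image and [p + m * h / 2] of the trapezoid. *)
pose u : R * R := (p, h / 2).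
have u0 : 0 < dot u u by rewrite /dot /u /=; nra.
have e2e1 : reflection e1 e2 = - e2.
  by rewrite /reflection /e1 /e2 /=; congr pair; rewrite /=; ring.
have [v _|v _||r r0] := circle_integral_indic_lt (w := e2) mT
  (measurable_reflection e1 mT) u0.
- move=> [vh vp vp'] nv; rewrite leNgt; apply/negP; rewrite /dot /e2 /= => v2.
  apply: nv; rewrite /trapezoid /reflection /e1 /=.
  by move/andP: vh => [? ?]; split; [apply/andP; split|..]; nra.
- move=> nv vT; rewrite leNgt; apply/negP; rewrite /dot /e2 /= => v2.
  apply: vT; move: nv; rewrite /trapezoid /reflection /e1 /= => -[/andP[? ?] ? ?].
  by split; [apply/andP; split|..]; nra.
- near=> v.
  have h1 : dot e2 v < h by near: v; apply: near_dot_lt; rewrite /dot /e2 /u /=; lra.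
  have h2 : 0 < dot e2 v by near: v; apply: near_dot_gt; rewrite /dot /e2 /u /=; lra.
  have h3 : 0 < dot e1 v by near: v; apply: near_dot_gt; rewrite /dot /e1 /u /=; lra.
  have h4 : dot (1, - m) v < p by near: v; apply: near_dot_lt; rewrite /dot /u /=; nra.
  have h5 : p < dot (1, m) v by near: v; apply: near_dot_gt; rewrite /dot /u /=; nra.
  move: h1 h2 h3 h4 h5; rewrite /dot /e1 /e2 /= => h1 h2 h3 h4 h5.
  split; last lra.
    by rewrite /trapezoid /=; split; [apply/andP; split|..]; nra.
  by rewrite /trapezoid /reflection /e1 /= => -[_ ? _]; lra.
- rewrite circle_integral_indic_reflection // e2e1 circle_integralN // !bT //.
  by rewrite oppr0 ltxx.
Unshelve. all: by end_near. Qed.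

Lemma balanced_trapezoid h p m q k : 0 < h -> h * `|m| < p -> h * `|k| < q ->
  balanced (trapezoid h p m q k) -> p = q /\ k = - m.
Proof.
move=> h0 mp kq bT.
have [] := @leg_inj h p `|m| q `|k| h0 mp kq (normr_ge0 m) (normr_ge0 k).
  by move=> r r0; rewrite !leg_moment_norm //; exact: balanced_trapezoid_leg bT.
move=> pq mk; split => //.
have [mk'|mk'] : m = k \/ k = - m.
  by case: (ger0P m) mk => _; case: (ger0P k) => _ ?; [left|right|right|left]; lra.
- subst q k.
  have m0 := isosceles_balanced_le0 h0 mp bT.
  (* Reflection across the first axis negates the slope, so the isosceles case forces [m = 0]. *)
  have : - m <= 0.
    apply: (@isosceles_balanced_le0 h p) => //; first by rewrite normrN.
    have := balanced_reflection unit_e1 bT; congr balanced.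
    by apply/seteqP; split => v; rewrite /trapezoid /reflection /e1 /= => -[/andP[? ?] ? ?];
      split; [apply/andP; split|..]; lra.
  lra.
- by [].
Qed.

End trapezoid.

(** * Normals of balanced triangles and quadrangles *)

Definition triangle_of {R : realType} (n0 n1 n2 : R * R) (d0 d1 d2 : R) :=
  [set v : R * R | [/\ dot n0 v <= d0, dot n1 v <= d1 & dot n2 v <= d2]].

Definition quadrangle_of {R : realType} (n0 n1 n2 n3 : R * R) (d0 d1 d2 d3 : R) :=
  [set v : R * R |
    [/\ dot n0 v <= d0, dot n1 v <= d1, dot n2 v <= d2 & dot n3 v <= d3]].

Section normals.
Context {R : realType}.
Implicit Types (n u v w p : R * R) (d h : R).

Lemma dotDl u v w : dot (u + v) w = dot u w + dot v w.
Proof. by rewrite /dot /=; ring. Qed.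

Lemma dotNl u w : dot (- u) w = - dot u w.
Proof. by rewrite /dot /=; ring. Qed.

Lemma dot0l w : dot 0 w = 0.
Proof. by rewrite /dot /= !mul0r addr0. Qed.

Lemma cross_neq u v : 0 < cross u v -> u != v.
Proof. by move=> uv; apply/eqP => E; move: uv; rewrite E /cross mulrC subrr ltxx. Qed.

Lemma unit_vector_neq0 u : unit_vector u -> u != 0.
Proof.
rewrite /unit_vector => u1; apply/eqP => E; move: u1.
by rewrite E dot0l => /eqP; rewrite eq_sym oner_eq0.
Qed.

Lemma cross_unit u v : unit_vector u -> unit_vector v -> cross u v ^+ 2 + dot u v ^+ 2 = 1.
Proof.
rewrite /unit_vector => u1 v1; transitivity (dot u u * dot v v).
  by rewrite /cross /dot; ring.
by rewrite u1 v1 mulr1.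
Qed.

(** The two products are the coordinates in the orthonormal frame starting with [u]. *)
Lemma dot_cross_inj u v w : unit_vector u -> dot u v = dot u w ->
  cross u v = cross u w -> v = w.
Proof.
case: v w => [v1 v2] [w1 w2]; rewrite /unit_vector /dot /cross /= => u1 D C.
congr pair; rewrite -[LHS]mul1r -[RHS]mul1r -u1.
  transitivity (u.1 * (u.1 * v1 + u.2 * v2) - u.2 * (u.1 * v2 - u.2 * v1)); first by ring.
  by rewrite D C; ring.
transitivity (u.2 * (u.1 * v1 + u.2 * v2) + u.1 * (u.1 * v2 - u.2 * v1)); first by ring.
by rewrite D C; ring.
Qed.

Lemma minimal_distance (I : finType) (i0 : I) (n : I -> R * R) (d : I -> R) p :
  injective n -> (forall i, unit_vector (n i)) -> balanced (polygon n d) ->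
  (forall i, dot (n i) p < d i) ->
  exists h, [/\ 0 < h, (forall i, h <= d i), exists i, d i = h
    & \sum_(i | d i == h) n i = 0].
Proof.
move=> n_inj n1 bP np; have d0 := balanced_polygon_gt0 bP np.
case: (@Order.TotalTheory.arg_minP _ _ _ i0 xpredT d isT) => i _ imin.
exists (d i); split=> //; first by move=> j; exact: imin.
  by exists i.
by apply: nearest_normals => // j; exact: imin.
Qed.

(** The nearest normals sum to 0. One unit vector is not 0, and two normals with positive cross
    product are not opposite, so all three sides are nearest. *)
Lemma balanced_triangle_normals n0 n1 n2 d0 d1 d2 p :
  unit_vector n0 -> unit_vector n1 -> unit_vector n2 ->
  0 < cross n0 n1 -> 0 < cross n1 n2 -> 0 < cross n2 n0 ->
  dot n0 p < d0 -> dot n1 p < d1 -> dot n2 p < d2 ->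
  balanced (triangle_of n0 n1 n2 d0 d1 d2) ->
  [/\ d1 = d0, d2 = d0 & n0 + n1 + n2 = 0].
Proof.
move=> u0 u1 u2 c01 c12 c20 p0 p1 p2 bT.
pose n (i : 'I_3) := nth 0 [:: n0; n1; n2] i.
pose d (i : 'I_3) := nth 0 [:: d0; d1; d2] i.
have all3 (P : 'I_3 -> Prop) : P ord0 -> P (inord 1) -> P (inord 2) -> forall i, P i.
  move=> P0 P1 P2 [[|[|[|//]]] i3].
  - by rewrite (_ : Ordinal _ = ord0) //; apply/val_inj.
  - by rewrite (_ : Ordinal _ = inord 1) //; apply/val_inj; rewrite /= inordK.
  - by rewrite (_ : Ordinal _ = inord 2) //; apply/val_inj; rewrite /= inordK.
have n_inj : injective n.
  have n_uniq : uniq [:: n0; n1; n2].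
    by rewrite /= !inE negb_or !(cross_neq c01) (eq_sym n0 n2) !(cross_neq c20) (cross_neq c12).
  by move=> i j /eqP; rewrite nth_uniq //; move/eqP/val_inj.
have n1' : forall i, unit_vector (n i) by apply: all3; rewrite /n ?inordK.
have np : forall i, dot (n i) p < d i by apply: all3; rewrite /n /d ?inordK.
have bP : balanced (polygon n d).
  suff <- : triangle_of n0 n1 n2 d0 d1 d2 = polygon n d by [].
  apply/seteqP; split => v.
    by move=> [? ? ?]; apply: all3; rewrite /n /d ?inordK.
  by move=> H; split; [have := H ord0|have := H (inord 1)|have := H (inord 2)];
    rewrite /n /d ?inordK.
have [h [_ _ [i di]]] := minimal_distance ord0 n_inj n1' bP np.
rewrite big_mkcond /= !big_ord_recl big_ord0 /n /d /= addr0.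
have nz0 := unit_vector_neq0 u0; have nz1 := unit_vector_neq0 u1.
have nz2 := unit_vector_neq0 u2.
have opp u v : 0 < cross u v -> u + v != 0.
  move=> uv; apply/eqP => /eqP; rewrite addr_eq0 => /eqP E.
  have cN : cross (- v) v = 0 by rewrite /cross /=; ring.
  by move: uv; rewrite E cN ltxx.
have := opp _ _ c01; have := opp _ _ c12; have := opp _ _ c20; rewrite (addrC n2).
have [->|d0h] := eqVneq d0 h; have [->|d1h] := eqVneq d1 h;
  have [->|d2h] := eqVneq d2 h; rewrite ?add0r ?addr0 => o20 o12 o01 /eqP;
  rewrite ?(negbTE nz0) ?(negbTE nz1) ?(negbTE nz2) ?(negbTE o01) ?(negbTE o12) ?(negbTE o20) //.
  by rewrite addrA => /eqP ->.
(* No nearest side at all: excluded, as the minimum [h] is attained. *)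
move=> _; exfalso; move: i di; apply: all3; rewrite /d ?inordK //= => /eqP; exact/negP.
Qed.

End normals.

(** * Equilateral triangles, strips, and the normals of a quadrangle *)

Section quadrangle_normals.
Context {R : realType}.
Implicit Types (n u v w p : R * R) (d h : R).

Let perp u : R * R := (- u.2, u.1).

Lemma measurable_triangle_of n0 n1 n2 d0 d1 d2 :
  measurable (triangle_of n0 n1 n2 d0 d1 d2 : set (R * R)).
Proof.
have -> : triangle_of n0 n1 n2 d0 d1 d2 = ~` cap n0 d0 `&` ~` cap n1 d1 `&` ~` cap n2 d2.
  apply/seteqP; split => v; rewrite /triangle_of /cap /=.
    by move=> [? ? ?]; split; [split|]; apply/negP; rewrite -leNgt.
  by move=> [[/negP + /negP +] /negP]; rewrite -!leNgt.
by do ?apply: measurableI; apply: measurableC; exact: measurable_cap.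
Qed.

Lemma measurable_quadrangle_of (n0 n1 n2 n3 : R * R) (d0 d1 d2 d3 : R) :
  measurable (quadrangle_of n0 n1 n2 n3 d0 d1 d2 d3).
Proof.
have -> : quadrangle_of n0 n1 n2 n3 d0 d1 d2 d3 = triangle_of n0 n1 n2 d0 d1 d2 `&` ~` cap n3 d3.
  apply/seteqP; split => v; rewrite /quadrangle_of /triangle_of /cap /=.
    by move=> [? ? ? ?]; split; [|apply/negP; rewrite -leNgt].
  by move=> [[? ? ?] /negP]; rewrite -leNgt.
apply: measurableI; first exact: measurable_triangle_of.
by apply: measurableC; exact: measurable_cap.
Qed.

Lemma equilateral_dot n0 n1 n2 : unit_vector n0 -> unit_vector n1 -> unit_vector n2 ->
  n0 + n1 + n2 = 0 -> dot n0 n1 = - 2^-1.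
Proof.
rewrite /unit_vector => u0 u1 u2 s0.
have E : n2 = - (n0 + n1) by apply/eqP; rewrite -addr_eq0 addrC s0.
move: u2; rewrite E.
have -> : dot (- (n0 + n1)) (- (n0 + n1)) = dot n0 n0 + dot n1 n1 + 2 * dot n0 n1.
  by rewrite /dot /=; ring.
by rewrite u0 u1 => ?; lra.
Qed.

(* The reflection across the line spanned by [n0] exchanges [n1] and [n2]. *)
Lemma equilateral_moment n0 n1 n2 h r : 0 < r ->
  unit_vector n0 -> unit_vector n1 -> unit_vector n2 -> n0 + n1 + n2 = 0 ->
  circle_integral r (fun v => \1_(triangle_of n0 n1 n2 h h h) v * dot (perp n0) v) = 0.
Proof.
move=> r0 u0 u1 u2 s0.
(* The complex square of [n0]: its angle is twice that of [n0], so the axis of the reflection is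
   spanned by [n0]. *)
pose a : R * R := (n0.1 ^+ 2 - n0.2 ^+ 2, 2 * n0.1 * n0.2).
have refE v : reflection a v = (2 * dot n0 v) *: n0 - dot n0 n0 *: v.
  by congr pair; rewrite /dot /= /GRing.scale /=; ring.
have ua : unit_vector a.
  transitivity (dot n0 n0 ^+ 2); first by rewrite /dot /=; ring.
  by rewrite u0 expr1n.
apply: (balanced_symmetric r0 ua); first exact: measurable_triangle_of.
- have ref0 v : dot n0 (reflection a v) = dot n0 v.
    transitivity (dot n0 n0 * dot n0 v); last by rewrite u0 mul1r.
    by rewrite refE /dot /= /GRing.scale /=; ring.
  have d12 v : dot n1 (reflection a v) = dot n2 v.
    have E : n2 = - (n0 + n1) by apply/eqP; rewrite -addr_eq0 addrC s0.
    transitivity (2 * dot n0 v * dot n0 n1 - dot n0 n0 * dot n1 v).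
      by rewrite refE /dot /= /GRing.scale /=; ring.
    rewrite u0 (equilateral_dot u0 u1 u2 s0) E dotNl dotDl; lra.
  have d21 v : dot n2 (reflection a v) = dot n1 v by rewrite -d12 reflectionK.
  apply/seteqP; split => v; rewrite /triangle_of /= ref0 d12 d21 => -[? ? ?]; by split.
- have p0 : dot n0 (perp n0) = 0 by rewrite /dot /perp /=; ring.
  by rewrite refE p0 mulr0 scale0r sub0r u0 scale1r.
Qed.

(** Cramer's rule. *)
Lemma cross_basis n0 n1 u : cross n0 n1 != 0 ->
  u = (cross u n1 / cross n0 n1) *: n0 + (cross n0 u / cross n0 n1) *: n1.
Proof.
case: n0 n1 u => [a b] [c d] [x y]; rewrite /cross /= => D.
by congr pair; rewrite /= /GRing.scale /=; field.
Qed.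

Lemma dot_basis_eq0 u v w : cross u v != 0 -> dot u w = 0 -> dot v w = 0 -> w = 0.
Proof.
move=> uv uw vw; apply: dot_self_eq0; rewrite [X in dot X _](cross_basis w uv).
have dZ (t : R) x : dot (t *: x) w = t * dot x w by rewrite /dot /= /GRing.scale /=; ring.
by rewrite dotDl !dZ uw vw !mulr0 addr0.
Qed.

(** By symmetry the moments along [perp n0] and [perp n1] vanish, and these two vectors form a
    basis. *)
Lemma equilateral_balanced n0 n1 n2 h :
  unit_vector n0 -> unit_vector n1 -> unit_vector n2 -> n0 + n1 + n2 = 0 ->
  balanced (triangle_of n0 n1 n2 h h h).
Proof.
move=> u0 u1 u2 s0; split=> [|r w r0]; first exact: measurable_triangle_of.
have C : cross (perp n0) (perp n1) != 0.
  have -> : cross (perp n0) (perp n1) = cross n0 n1 by rewrite /cross /perp /=; ring.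
  apply/eqP => C; have := cross_unit u0 u1.
  by rewrite C (equilateral_dot u0 u1 u2 s0) => {s0 C} ?; lra.
have rot : triangle_of n0 n1 n2 h h h = triangle_of n1 n2 n0 h h h.
  by apply/seteqP; split => v [? ? ?]; split.
rewrite (cross_basis w C) circle_integral_dotD ?circle_integral_dotZ;
  try exact: measurable_triangle_of.
rewrite equilateral_moment // rot equilateral_moment ?mulr0 ?addr0 //.
by rewrite -s0 addrC addrA.
Qed.

(** The removed corner lies in the half-plane [d < dot n3 v] with [d > 0], so its moment along [n3]
    cannot vanish on every circle, whereas that of the full triangle does. *)
Lemma truncated_equilateral_unbalanced n0 n1 n2 n3 h d p :
  unit_vector n0 -> unit_vector n1 -> unit_vector n2 -> unit_vector n3 ->
  n0 + n1 + n2 = 0 -> 0 < d ->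
  dot n0 p < h -> dot n1 p < h -> dot n2 p < h -> dot n3 p = d ->
  ~ balanced (quadrangle_of n0 n1 n2 n3 h h h d).
Proof.
move=> u0 u1 u2 u3 s0 d0 p0 p1 p2 p3 [mQ bQ].
have [mT bT] := equilateral_balanced h u0 u1 u2 s0.
pose e := Num.min (h - dot n0 p) (Num.min (h - dot n1 p) (h - dot n2 p)).
have e0 : 0 < e by rewrite !lt_min !subr_gt0 p0 p1 p2.
(* A point just beyond the truncating side; [e] is the least slack of [p], so half of it keeps [u]
   inside the triangle. *)
pose u := p + (e / 2) *: n3.
have dotu n : dot n u = dot n p + e / 2 * dot n n3.
  by rewrite /u /dot /= /GRing.scale /=; ring.
have inside n : unit_vector n -> e <= h - dot n p -> dot n u < h.
  move=> un en; have := @dot_le R 1 n n3 ltr01 un; rewrite expr1n => /(_ u3).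
  by rewrite dotu; nra.
have v0 : dot n0 u < h by apply: inside => //; rewrite ge_min lexx.
have v1 : dot n1 u < h by apply: inside => //; rewrite !ge_min lexx orbT.
have v2 : dot n2 u < h by apply: inside => //; rewrite !ge_min lexx !orbT.
have v3 : d < dot n3 u by rewrite dotu p3 u3; lra.
have uu : 0 < dot u u.
  by apply: (@dot_self_gt0 _ n3); rewrite gt_eqF // (lt_trans d0 v3).
have [v _ [t0 t1 t2] nQ|v _ [q0 q1 q2 _] nT||r r0] :=
  circle_integral_indic_lt (w := n3) mT mQ uu.
- rewrite leNgt; apply/negP => n3v; apply: nQ; split=> //.
  exact: ltW (lt_trans n3v d0).
- by exfalso; apply: nT.
- near=> v; split.
  + by split; apply: ltW; near: v; exact: near_dot_lt.
  + have n3v : d < dot n3 v by near: v; exact: near_dot_gt.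
    by move=> [_ _ _]; rewrite leNgt n3v.
  + by near: v; apply: near_dot_gt; exact: lt_trans v3.
- by rewrite bT // bQ // ltxx.
Unshelve. all: by end_near. Qed.

(* Reflecting [n0] to (0, 1) turns the region into a trapezoid. *)
Lemma strip_parallelogram n0 n1 n3 h d1 d3 :
  unit_vector n0 -> unit_vector n1 -> unit_vector n3 ->
  0 < cross n0 n1 -> 0 < cross n3 n0 -> 0 < h -> h <= d1 -> h <= d3 ->
  balanced (quadrangle_of n0 n1 (- n0) n3 h d1 h d3) ->
  n3 = - n1 /\ d3 = d1.
Proof.
move=> u0 u1 u3 c1 c3 h0 hd1 hd3 bQ.
pose a : R * R := (- n0.2, n0.1).
have ua : unit_vector a.
  by transitivity (dot n0 n0) => //; rewrite /a /dot /=; ring.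
(* After the reflection, [n1] becomes [(x1, y1)] and [n3] becomes [(- x3, y3)], with positive [x1]
   and [x3]: one side on each side of the vertical axis. *)
set x1 := cross n0 n1 in c1; set x3 := cross n3 n0 in c3.
set y1 := dot n0 n1; set y3 := dot n0 n3.
have xy1 : x1 ^+ 2 + y1 ^+ 2 = 1 by exact: cross_unit.
have xy3 : x3 ^+ 2 + y3 ^+ 2 = 1.
  by rewrite -(cross_unit u3 u0) /y3 /dot; congr (_ + _ ^+ 2); ring.
have d0 v : dot n0 (reflection a v) = v.2.
  transitivity (dot n0 n0 * v.2); last by rewrite u0 mul1r.
  by rewrite /reflection /a /dot /=; ring.
have d1E v : dot n1 (reflection a v) = x1 * v.1 + y1 * v.2.
  by rewrite /reflection /a /x1 /y1 /dot /cross /=; ring.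
have d3E v : dot n3 (reflection a v) = - x3 * v.1 + y3 * v.2.
  by rewrite /reflection /a /x3 /y3 /dot /cross /=; ring.
(* This is [h * |y| < d] divided by [x], and [|y| < 1] as [x] is positive. *)
have slope x y d : 0 < x -> x ^+ 2 + y ^+ 2 = 1 -> h <= d -> h * `|- (y / x)| < d / x.
  move=> x0 xy hd; rewrite normrN normrM (gtr0_norm (x := x^-1)) ?invr_gt0 // mulrA.
  rewrite ltr_pM2r ?invr_gt0 //; apply: lt_le_trans hd.
  rewrite gtr_pMr // ltr_norml; apply/andP; split; nra.
have E : reflection a @^-1` quadrangle_of n0 n1 (- n0) n3 h d1 h d3 =
    trapezoid h (d1 / x1) (- (y1 / x1)) (d3 / x3) (- (y3 / x3)).
  have x1N0 : x1 != 0 by rewrite gt_eqF.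
  have x3N0 : x3 != 0 by rewrite gt_eqF.
  have side1 v : (dot n1 (reflection a v) <= d1) = (v.1 <= d1 / x1 + - (y1 / x1) * v.2).
    have -> : d1 / x1 + - (y1 / x1) * v.2 = (d1 - y1 * v.2) / x1 by field.
    by rewrite ler_pdivlMr // d1E; apply/idP/idP => ?; lra.
  have side3 v : (dot n3 (reflection a v) <= d3) = (- v.1 <= d3 / x3 + - (y3 / x3) * v.2).
    have -> : d3 / x3 + - (y3 / x3) * v.2 = (d3 - y3 * v.2) / x3 by field.
    by rewrite ler_pdivlMr // d3E; apply/idP/idP => ?; lra.
  apply/seteqP; split => v; rewrite /quadrangle_of /trapezoid /= dotNl d0 side1 side3.
    by move=> [? ? ? ?]; split=> //; apply/andP; split; lra.
  by move=> [/andP[? ?] ? ?]; split=> //; lra.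
have := balanced_reflection ua bQ; rewrite E.
move=> /(balanced_trapezoid h0 (slope _ _ _ c1 xy1 hd1) (slope _ _ _ c3 xy3 hd3))[pq mk].
have x1N0 : x1 != 0 by rewrite gt_eqF.
have x3N0 : x3 != 0 by rewrite gt_eqF.
have y1E : y1 = y1 / x1 * x1 by rewrite divfK.
have y3E : y3 = - (y1 / x1) * x3 by rewrite -[LHS](divfK x3N0); congr (_ * _); lra.
(* Opposite slopes and unit length determine the horizontal components, which are positive. *)
have xx : x3 = x1.
  move: xy1 xy3; rewrite y3E [in X in X -> _]y1E; set s := y1 / x1 => {}xy1 {}xy3.
  have : (x3 - x1) * ((x3 + x1) * (1 + s ^+ 2)) = 0 by nra.
  move=> /eqP; rewrite mulf_eq0 => /orP[|]; first by rewrite subr_eq0 => /eqP.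
  have s1 : 0 < 1 + s ^+ 2 by have := sqr_ge0 s; lra.
  by rewrite gt_eqF // mulr_gt0 // addr_gt0.
split; last by move: pq; rewrite xx => /mulIf -> //; rewrite invr_neq0.
apply: (dot_cross_inj u0).
  transitivity (- y1); last by rewrite /y1 /dot /=; ring.
  by rewrite -/y3 y3E xx mulNr divfK.
transitivity (- x3); first by rewrite /x3 /cross; ring.
by rewrite xx /x1 /cross /=; ring.
Qed.

Lemma quadrangle_rot n0 n1 n2 n3 d0 d1 d2 d3 :
  quadrangle_of n0 n1 n2 n3 d0 d1 d2 d3 = quadrangle_of n1 n2 n3 n0 d1 d2 d3 d0.
Proof. by apply/seteqP; split => v [? ? ? ?]; split. Qed.

(* [n0 + n2 = - (n1 + n3)] is orthogonal to both [n0 - n2] and [n1 - n3], which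
   are linearly independent. *)
Lemma rhombus n0 n1 n2 n3 :
  unit_vector n0 -> unit_vector n1 -> unit_vector n2 -> unit_vector n3 ->
  0 < cross n0 n1 -> 0 < cross n1 n2 -> 0 < cross n2 n3 -> 0 < cross n3 n0 ->
  n0 + n2 + (n1 + n3) = 0 -> n0 + n2 = 0.
Proof.
rewrite /unit_vector => u0 u1 u2 u3 c01 c12 c23 c30 s0.
have E : n0 + n2 = - (n1 + n3) by apply/eqP; rewrite -addr_eq0 s0.
set q := n0 + n2.
have q02 : dot q (n0 - n2) = 0.
  transitivity (dot n0 n0 - dot n2 n2); first by rewrite /q /dot /=; ring.
  by rewrite u0 u2 subrr.
have q13 : dot q (n1 - n3) = 0.
  transitivity (dot n3 n3 - dot n1 n1); first by rewrite /q E /dot /=; ring.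
  by rewrite u1 u3 subrr.
have C : cross (n0 - n2) (n1 - n3) != 0.
  have -> : cross (n0 - n2) (n1 - n3) = cross n0 n1 + cross n1 n2 + cross n2 n3 + cross n3 n0.
    by rewrite /cross /=; ring.
  by apply: lt0r_neq0; lra.
apply: dot_self_eq0; rewrite [X in dot _ X](cross_basis q C).
rewrite [LHS](_ : _ = cross q (n1 - n3) / cross (n0 - n2) (n1 - n3) * dot q (n0 - n2) +
  cross (n0 - n2) q / cross (n0 - n2) (n1 - n3) * dot q (n1 - n3)).
  by rewrite q02 q13 !mulr0 addr0.
by rewrite /dot /= /GRing.scale /=; ring.
Qed.

(** Case analysis on the set of nearest sides. Each [m] is a point in the relative interior of one
    side: it shows that this side really truncates the region cut out by the other three. *)
Lemma balanced_quadrangle_normals n0 n1 n2 n3 d0 d1 d2 d3 m0 m1 m2 m3 :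
  unit_vector n0 -> unit_vector n1 -> unit_vector n2 -> unit_vector n3 ->
  0 < cross n0 n1 -> 0 < cross n1 n2 -> 0 < cross n2 n3 -> 0 < cross n3 n0 ->
  [/\ dot n0 m0 = d0, dot n1 m0 < d1, dot n2 m0 < d2 & dot n3 m0 < d3] ->
  [/\ dot n0 m1 < d0, dot n1 m1 = d1, dot n2 m1 < d2 & dot n3 m1 < d3] ->
  [/\ dot n0 m2 < d0, dot n1 m2 < d1, dot n2 m2 = d2 & dot n3 m2 < d3] ->
  [/\ dot n0 m3 < d0, dot n1 m3 < d1, dot n2 m3 < d2 & dot n3 m3 = d3] ->
  balanced (quadrangle_of n0 n1 n2 n3 d0 d1 d2 d3) ->
  [/\ n2 = - n0, n3 = - n1, d2 = d0 & d3 = d1].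
Proof.
move=> u0 u1 u2 u3 c01 c12 c23 c30 [e00 e01 e02 e03] [e10 e11 e12 e13]
  [e20 e21 e22 e23] [e30 e31 e32 e33] bQ.
pose n (i : 'I_4) := nth 0 [:: n0; n1; n2; n3] i.
pose d (i : 'I_4) := nth 0 [:: d0; d1; d2; d3] i.
have all4 (P : 'I_4 -> Prop) : P ord0 -> P (inord 1) -> P (inord 2) -> P (inord 3) ->
    forall i, P i.
  move=> P0 P1 P2 P3 [[|[|[|[|//]]]] i3].
  - by rewrite (_ : Ordinal _ = ord0) //; apply/val_inj.
  - by rewrite (_ : Ordinal _ = inord 1) //; apply/val_inj; rewrite /= inordK.
  - by rewrite (_ : Ordinal _ = inord 2) //; apply/val_inj; rewrite /= inordK.
  - by rewrite (_ : Ordinal _ = inord 3) //; apply/val_inj; rewrite /= inordK.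
have crossN (u v : R * R) : cross u v = - cross v u by rewrite /cross; ring.
have n02 : n0 != n2 by apply: contraTneq c01 => ->; rewrite crossN -leNgt oppr_le0 ltW.
have n13 : n1 != n3 by apply: contraTneq c12 => ->; rewrite crossN -leNgt oppr_le0 ltW.
have n_inj : injective n.
  have n_uniq : uniq [:: n0; n1; n2; n3].
    rewrite /= !inE !negb_or (cross_neq c01) n02 (eq_sym n0 n3) (cross_neq c30).
    by rewrite (cross_neq c12) n13 (cross_neq c23).
  by move=> i j /eqP; rewrite nth_uniq //; move/eqP/val_inj.
have n1' : forall i, unit_vector (n i) by apply: all4; rewrite /n ?inordK.
(* The midpoint of points interior to two different sides is interior to the quadrangle. *)
pose p := (1 / 2 : R) *: (m0 + m1).
have dotp (u : R * R) : dot u p = (dot u m0 + dot u m1) / 2.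
  by rewrite /p /dot /= /GRing.scale /=; field.
have np : forall i, dot (n i) p < d i by apply: all4; rewrite /n /d ?inordK //= dotp; lra.
have bP : balanced (polygon n d).
  suff <- : quadrangle_of n0 n1 n2 n3 d0 d1 d2 d3 = polygon n d by [].
  apply/seteqP; split => v.
    by move=> [? ? ? ?]; apply: all4; rewrite /n /d ?inordK.
  by move=> H; split; [have := H ord0|have := H (inord 1)|have := H (inord 2)|
    have := H (inord 3)];
    rewrite /n /d ?inordK.
have [h [h0 hd [i di]]] := minimal_distance ord0 n_inj n1' bP np.
have h_0 : h <= d0 by exact: (hd ord0).
have h_1 : h <= d1 by have := hd (inord 1); rewrite /d inordK.
have h_2 : h <= d2 by have := hd (inord 2); rewrite /d inordK.
have h_3 : h <= d3 by have := hd (inord 3); rewrite /d inordK.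
have pair02 : d0 = h -> d2 = h -> n2 = - n0 -> [/\ n2 = - n0, n3 = - n1, d2 = d0 & d3 = d1].
  move=> E0 E2 En; move: bQ; rewrite En E0 E2 => bQ.
  by have [-> ->] := strip_parallelogram u0 u1 u3 c01 c30 h0 h_1 h_3 bQ.
have pair13 : d1 = h -> d3 = h -> n3 = - n1 -> [/\ n2 = - n0, n3 = - n1, d2 = d0 & d3 = d1].
  move=> E1 E3 En; move: bQ; rewrite quadrangle_rot En E1 E3 => bQ.
  have [-> ->] := strip_parallelogram u1 u2 u0 c12 c01 h0 h_2 h_0 bQ.
  by rewrite opprK.
rewrite big_mkcond /= !big_ord_recl big_ord0 /n /d /= addr0.
have nz0 := unit_vector_neq0 u0; have nz1 := unit_vector_neq0 u1.
have nz2 := unit_vector_neq0 u2; have nz3 := unit_vector_neq0 u3.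
have opp u v : 0 < cross u v -> u + v != 0.
  move=> uv; apply/eqP => /eqP; rewrite addr_eq0 => /eqP E.
  have cN : cross (- v) v = 0 by rewrite /cross /=; ring.
  by move: uv; rewrite E cN ltxx.
have o01 := negbTE (opp _ _ c01); have o12 := negbTE (opp _ _ c12).
have o23 := negbTE (opp _ _ c23); have o30 := negbTE (opp _ _ c30).
rewrite addrC in o30.
(* Of the sixteen subsets, single sides and adjacent pairs have a nonzero sum of normals. There
   remain all four sides, the triples, the opposite pairs and the empty set. *)
have [E0|N0] := eqVneq d0 h; have [E1|N1] := eqVneq d1 h;
  have [E2|N2] := eqVneq d2 h; have [E3|N3] := eqVneq d3 h; rewrite ?add0r ?addr0 => sum0;
  try by move/eqP: sum0; rewrite ?(negbTE nz0) ?(negbTE nz1) ?(negbTE nz2)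
    ?(negbTE nz3) ?o01 ?o12 ?o23 ?o30.
- have q0 : n0 + n2 = 0.
    apply: (@rhombus n0 n1 n2 n3) => //.
    by rewrite -[RHS]sum0 !addrA (addrAC n0).
  have En : n2 = - n0 by apply/eqP; rewrite -addr_eq0 addrC q0.
  exact: pair02.
- exfalso; apply: (@truncated_equilateral_unbalanced n0 n1 n2 n3 h d3 m3) => //.
  + by rewrite -addrA.
  + lra.
  + lra.
  + lra.
  + lra.
  + by move: bQ; rewrite E0 E1 E2.
(* The sides are rotated so that the one that is not nearest comes last; likewise for the other
   triples. *)
- exfalso; apply: (@truncated_equilateral_unbalanced n3 n0 n1 n2 h d2 m2) => //.
  + by rewrite -addrA addrC -addrA.
  + lra.
  + lra.
  + lra.
  + lra.
  + by move: bQ; rewrite 3!quadrangle_rot E0 E1 E3.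
- exfalso; apply: (@truncated_equilateral_unbalanced n2 n3 n0 n1 h d1 m1) => //.
  + by rewrite addrC.
  + lra.
  + lra.
  + lra.
  + lra.
  + by move: bQ; rewrite 2!quadrangle_rot E0 E2 E3.
- by apply: pair02 => //; apply/eqP; rewrite -addr_eq0 addrC sum0.
- exfalso; apply: (@truncated_equilateral_unbalanced n1 n2 n3 n0 h d0 m0) => //.
  + by rewrite -addrA.
  + lra.
  + lra.
  + lra.
  + lra.
  + by move: bQ; rewrite quadrangle_rot E1 E2 E3.
- by apply: pair13 => //; apply/eqP; rewrite -addr_eq0 addrC sum0.
- exfalso; move: i di; apply: all4; rewrite /d ?inordK //= => /eqP; exact/negP.
Qed.

End quadrangle_normals.

(** * From convex hulls to half-planes *)

Section hull.
Context {R : realType}.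
Implicit Types (a b c d u v w x y z : R * R) (S : set (R * R)).

Lemma conv_hull_conv S x y (t : R) : 0 <= t <= 1 -> conv_hull S x -> conv_hull S y ->
  conv_hull S (t *: x + (1 - t) *: y).
Proof.
move=> /andP[t0 t1] Sx Sy M [cM SM].
have /(_ x y (Itv01 t0 t1)) := cM.
by rewrite !inE; apply; [apply: Sx|apply: Sy].
Qed.

Lemma conv_hull_sub S x : S x -> conv_hull S x.
Proof. by move=> Sx M [_ SM]; exact: SM. Qed.

Lemma conv_hullS S S' x : S `<=` S' -> conv_hull S x -> conv_hull S' x.
Proof. by move=> SS' + M [cM SM]; apply; split=> // y /SS'; exact: SM. Qed.

Lemma conv_hull_conv3 S x y z (r s t : R) : 0 <= r -> 0 <= s -> 0 <= t ->
  r + s + t = 1 -> conv_hull S x -> conv_hull S y -> conv_hull S z ->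
  conv_hull S (r *: x + s *: y + t *: z).
Proof.
move=> r0 s0 t0 rst Sx Sy Sz.
(* The nested combination divides by [1 - t], so [t = 1] is treated apart. *)
have [t1|t1] := eqVneq t 1.
  have -> : r = 0 by lra.
  have -> : s = 0 by lra.
  by rewrite t1 !scale0r !add0r scale1r.
have t1' : 0 < 1 - t by rewrite subr_gt0 lt_neqAle t1 /=; lra.
have E : s / (1 - t) = 1 - r / (1 - t).
  have -> : s = 1 - t - r by lra.
  by field; rewrite gt_eqF.
have := @conv_hull_conv S (r / (1 - t) *: x + (s / (1 - t)) *: y) z (1 - t).
rewrite scalerDr !scalerA !(mulrC (1 - t)) !divfK ?gt_eqF // opprB addrCA subrr addr0.
apply=> //; first by apply/andP; split; lra.
rewrite E; apply: conv_hull_conv => //.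
by rewrite divr_ge0 ?(ltW t1') //= ler_pdivrMr //; lra.
Qed.

(** Twice the signed area of the triangle, positive in counterclockwise order. *)
Definition orient a b c := cross (b - a) (c - a).

(** A half-plane is convex, so it contains the hull as soon as it contains [S]. *)
Lemma conv_hull_orient_ge0 S a b v : (forall x, S x -> 0 <= orient a b x) ->
  conv_hull S v -> 0 <= orient a b v.
Proof.
move=> Sab /(_ [set x | 0 <= orient a b x]); apply; split=> // x y t.
rewrite !inE /= => x0 y0.
have -> : orient a b (@conv R (convex_lmodType (R * R)%type) t x y) =
    t%:num * orient a b x + (1 - t%:num) * orient a b y.
  by rewrite /orient /cross /conv /= /GRing.scale /=; rewrite /unstable.onem; ring.
by rewrite addr_ge0 // mulr_ge0 // subr_ge0.
Qed.

Lemma orient_rot a b c : orient b c a = orient a b c.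
Proof. by rewrite /orient /cross /=; ring. Qed.

Lemma orient_swap a b c : orient b a c = - orient a b c.
Proof. by rewrite /orient /cross /=; ring. Qed.

(** Barycentric coordinates as ratios of signed areas. *)
Lemma barycentric a b c v : orient a b c != 0 ->
  v = (orient b c v / orient a b c) *: a + (orient c a v / orient a b c) *: b +
      (orient a b v / orient a b c) *: c.
Proof.
case: a b c v => [a1 a2] [b1 b2] [c1 c2] [v1 v2]; rewrite /orient /cross /= => D.
by congr pair; rewrite /= /GRing.scale /=; field.
Qed.

Lemma in_triangle S a b c v : 0 < orient a b c -> S a -> S b -> S c ->
  0 <= orient a b v -> 0 <= orient b c v -> 0 <= orient c a v -> conv_hull S v.
Proof.
move=> abc Sa Sb Sc vab vbc vca; have N0 : orient a b c != 0 by rewrite gt_eqF.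
rewrite (barycentric v N0).
apply: conv_hull_conv3; try exact: conv_hull_sub; try by rewrite divr_ge0 // ltW.
rewrite -!mulrDl.
have -> : orient b c v + orient c a v + orient a b v = orient a b c.
  by rewrite /orient /cross /=; ring.
exact: divff.
Qed.

(** The edge vector turned clockwise by a right angle and normalized: it points outward when the
    vertices run counterclockwise. *)
Definition edge_normal a b : R * R :=
  (Num.sqrt (dot (b - a) (b - a)))^-1 *: ((b - a).2, - (b - a).1).

Definition edge_dist a b : R := dot (edge_normal a b) a.

Lemma edge_length_gt0 a b : a != b -> 0 < Num.sqrt (dot (b - a) (b - a)).
Proof.
move=> ab; rewrite sqrtr_gt0 lt_def dot_self_ge0 andbT.
by apply: contra ab => /eqP/dot_self_eq0/eqP; rewrite subr_eq0 eq_sym.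
Qed.

Lemma unit_edge_normal a b : a != b -> unit_vector (edge_normal a b).
Proof.
move=> ab; rewrite /unit_vector /edge_normal; have l0 := edge_length_gt0 ab.
set l := Num.sqrt _ in l0 *.
have -> : dot (l^-1 *: ((b - a).2, - (b - a).1)) (l^-1 *: ((b - a).2, - (b - a).1)) =
    l^-1 * l^-1 * dot (b - a) (b - a) by rewrite /dot /= /GRing.scale /=; ring.
have -> : dot (b - a) (b - a) = l ^+ 2 by rewrite sqr_sqrtr ?dot_self_ge0.
by field; rewrite gt_eqF.
Qed.

Lemma dot_edge_normal a b v : dot (edge_normal a b) v =
  edge_dist a b - orient a b v / Num.sqrt (dot (b - a) (b - a)).
Proof.
rewrite /edge_dist /edge_normal; set l := Num.sqrt _.
by rewrite /dot /orient /cross /= /GRing.scale /=; ring.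
Qed.

Lemma edge_le a b v : a != b ->
  (dot (edge_normal a b) v <= edge_dist a b) = (0 <= orient a b v).
Proof.
by move=> ab; rewrite dot_edge_normal gerBl pmulr_lge0 // invr_gt0 edge_length_gt0.
Qed.

Lemma edge_lt a b v : a != b ->
  (dot (edge_normal a b) v < edge_dist a b) = (0 < orient a b v).
Proof.
by move=> ab; rewrite dot_edge_normal gtrBl pmulr_lgt0 // invr_gt0 edge_length_gt0.
Qed.

Lemma edge_eq a b v : orient a b v = 0 -> dot (edge_normal a b) v = edge_dist a b.
Proof. by rewrite dot_edge_normal => ->; rewrite mul0r subr0. Qed.

Lemma orient_neq a b c : 0 < orient a b c -> a != b.
Proof.
move=> abc; apply: contraTneq abc => ->.
by rewrite /orient subrr /cross /= !mul0r subrr ltxx.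
Qed.

(** Turning both edges by the same right angle preserves their cross product, which is
    [orient a b c] before normalization. *)
Lemma cross_edge_normal a b c : 0 < orient a b c ->
  0 < cross (edge_normal a b) (edge_normal b c).
Proof.
move=> abc; have l1 := edge_length_gt0 (orient_neq abc).
have l2 : 0 < Num.sqrt (dot (c - b) (c - b)).
  by apply: edge_length_gt0; apply: (@orient_neq _ _ a); rewrite orient_rot.
rewrite /edge_normal; set l := Num.sqrt _ in l1 *; set l' := Num.sqrt _ in l2 *.
have -> : cross (l^-1 *: ((b - a).2, - (b - a).1)) (l'^-1 *: ((c - b).2, - (c - b).1)) =
  l^-1 * l'^-1 * orient a b c.
  by rewrite /orient /cross /= /GRing.scale /=; ring.
by rewrite !mulr_gt0 // invr_gt0.
Qed.

Lemma conv_hull_triangle a b c : 0 < orient a b c ->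
  conv_hull [set a; b; c] =
  triangle_of (edge_normal a b) (edge_normal b c) (edge_normal c a)
    (edge_dist a b) (edge_dist b c) (edge_dist c a).
Proof.
move=> abc; have bca : 0 < orient b c a by rewrite orient_rot.
have cab : 0 < orient c a b by rewrite orient_rot.
have o1 (x y : R * R) : orient x y x = 0 by rewrite /orient /cross /=; ring.
have o2 (x y : R * R) : orient x y y = 0 by rewrite /orient /cross /=; ring.
have nab := orient_neq abc; have nbc := orient_neq bca; have nca := orient_neq cab.
apply/seteqP; split => v; rewrite /triangle_of /= !edge_le //.
- by move=> Sv; split; apply: conv_hull_orient_ge0 Sv => x [[->|->]|->];
    rewrite ?o1 ?o2 // ltW.
- move=> [? ? ?]; apply: (@in_triangle _ a b c) => //; rewrite /=; tauto.
Qed.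

Lemma conv_hull_quadrangle a b c d :
  0 < orient a b c -> 0 < orient b c d -> 0 < orient c d a -> 0 < orient d a b ->
  conv_hull [set a; b; c; d] =
  quadrangle_of (edge_normal a b) (edge_normal b c) (edge_normal c d) (edge_normal d a)
    (edge_dist a b) (edge_dist b c) (edge_dist c d) (edge_dist d a).
Proof.
move=> abc bcd cda dab.
have o1 (x y : R * R) : orient x y x = 0 by rewrite /orient /cross /=; ring.
have o2 (x y : R * R) : orient x y y = 0 by rewrite /orient /cross /=; ring.
have abd : 0 < orient a b d by rewrite orient_rot.
have bca : 0 < orient b c a by rewrite orient_rot.
have cdb : 0 < orient c d b by rewrite orient_rot.
have dac : 0 < orient d a c by rewrite orient_rot.
have nab := orient_neq abc; have nbc := orient_neq bcd.
have ncd := orient_neq cda; have nda := orient_neq dab.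
apply/seteqP; split => v; rewrite /quadrangle_of /= !edge_le //.
- by move=> Sv; split; apply: conv_hull_orient_ge0 Sv => x [[[->|->]|->]|->];
    rewrite ?o1 ?o2 // ltW.
(* The diagonal through [a] and [c] cuts the quadrangle into two triangles; the sign tells which one
   contains [v]. *)
- move=> [? ? ? ?]; have [ca|ca] := leP 0 (orient c a v).
    by apply: (@in_triangle _ a b c) => //; rewrite /=; tauto.
  apply: (@in_triangle _ a c d) => //; rewrite /=; try tauto.
  + by rewrite -orient_rot -orient_rot.
  + by rewrite orient_swap; lra.
Qed.

End hull.

(** * Vertices of balanced triangles and quadrangles *)

Section main.
Context {R : realType}.
Implicit Types (a b c d u v w x y z : R * R) (Omega : set (R * R)).

Let orient1 x y : orient x y x = 0. Proof. by rewrite /orient /cross /=; ring. Qed.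
Let orient2 x y : orient x y y = 0. Proof. by rewrite /orient /cross /=; ring. Qed.

Lemma balanced_triangle a b c Omega : 0 < orient a b c ->
  Omega = conv_hull [set a; b; c] -> balance_law Omega ->
  [/\ Defs.edist a b = Defs.edist b c, Defs.edist b c = Defs.edist c a & a + b + c = 0].
Proof.
move=> abc ->; rewrite conv_hull_triangle // => /balance_law_balanced bT.
have {bT} bT := bT (measurable_triangle_of _ _ _ _ _ _).
have bca : 0 < orient b c a by rewrite orient_rot.
have cab : 0 < orient c a b by rewrite orient_rot.
have nab := orient_neq abc; have nbc := orient_neq bca; have nca := orient_neq cab.
have c01 := cross_edge_normal abc; have c12 := cross_edge_normal bca.
have c20 := cross_edge_normal cab.
have u0 := unit_edge_normal nab; have u1 := unit_edge_normal nbc.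
have u2 := unit_edge_normal nca.
pose p := (3^-1 : R) *: (a + b + c).
have op x y : orient x y p = (orient x y a + orient x y b + orient x y c) / 3.
  by rewrite /p /orient /cross /= /GRing.scale /=; field.
have p0 : dot (edge_normal a b) p < edge_dist a b by rewrite edge_lt // op orient1 orient2; lra.
have p1 : dot (edge_normal b c) p < edge_dist b c by rewrite edge_lt // op orient1 orient2; lra.
have p2 : dot (edge_normal c a) p < edge_dist c a by rewrite edge_lt // op orient1 orient2; lra.
have [E1 E2 sum0] := balanced_triangle_normals u0 u1 u2 c01 c12 c20 p0 p1 p2 bT.
have a2 := edge_eq (orient2 c a); have b0 := edge_eq (orient2 a b).
have c1 := edge_eq (orient2 b c).
have a0 : dot (edge_normal a b) a = edge_dist a b by [].
have b1 : dot (edge_normal b c) b = edge_dist b c by [].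
have c2 : dot (edge_normal c a) c = edge_dist c a by [].
move: E1 E2 sum0 u0 u1 u2 a0 b0 b1 c1 c2 a2 c01 c12 c20 {bT p0 p1 p2}.
move: (edge_normal a b) (edge_normal b c) (edge_normal c a) (edge_dist a b)
  (edge_dist b c) (edge_dist c a) => n0 n1 n2 h ? ? -> -> sum0
  u0 u1 u2 a0 b0 b1 c1 c2 a2 c01 c12 c20.
(* A vertex lies on two sides at distance [h]; as the normals sum to 0, it is [- 2 * h] times the
   normal of the opposite side. *)
have vertex m0 m1 m2 x : unit_vector m0 -> unit_vector m1 -> unit_vector m2 ->
    m0 + m1 + m2 = 0 -> 0 < cross m0 m1 -> dot m0 x = h -> dot m2 x = h ->
    x = (- 2 * h) *: m1.
  move=> v0 v1 v2 s0 C x0 x2.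
  have x1 : dot m1 x = - 2 * h.
    have : dot (m0 + m1 + m2) x = 0 by rewrite s0 dot0l.
    by rewrite !dotDl x0 x2 => ?; lra.
  have dB m : dot m (x - (- 2 * h) *: m1) = dot m x + 2 * h * dot m m1.
    by rewrite /dot /= /GRing.scale /=; ring.
  apply/eqP; rewrite -subr_eq0; apply/eqP.
  apply: (@dot_basis_eq0 _ m0 m1); rewrite ?gt_eqF // dB.
    by rewrite x0 (equilateral_dot v0 v1 v2 s0); lra.
  by rewrite x1 v1; lra.
have s1 : n1 + n2 + n0 = 0 by rewrite addrC addrA.
have s2 : n2 + n0 + n1 = 0 by rewrite -addrA addrC.
have Ea := vertex _ _ _ _ u0 u1 u2 sum0 c01 a0 a2.
have Eb := vertex _ _ _ _ u1 u2 u0 s1 c12 b1 b0.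
have Ec := vertex _ _ _ _ u2 u0 u1 s2 c20 c2 c1.
(* The constant 12 is 4 times [1 + 1 - 2 * (- 2^-1) = 3]. *)
have side m m' : unit_vector m -> unit_vector m' -> dot m m' = - 2^-1 ->
    Defs.edist ((- 2 * h) *: m) ((- 2 * h) *: m') = Num.sqrt (12 * h ^+ 2).
  rewrite /unit_vector => um um' mm'; rewrite /Defs.edist /enorm; congr Num.sqrt.
  transitivity (4 * h ^+ 2 * (dot m m + dot m' m' - 2 * dot m m')).
    by rewrite /dot /= /GRing.scale /=; ring.
  by rewrite um um' mm'; field.
rewrite Ea Eb Ec !side ?(equilateral_dot u0 u1 u2) ?(equilateral_dot u1 u2 u0)
  ?(equilateral_dot u2 u0 u1) //.
by split=> //; rewrite -!scalerDr s1 scaler0.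
Qed.

Lemma triangle_equilateral Omega : is_triangle Omega -> balance_law Omega ->
  is_centered_equilateral_triangle Omega.
Proof.
move=> [a [b [c [nc E]]]] bO.
have abc0 : orient a b c != 0.
  apply/eqP => abc; apply: nc; rewrite /collinear /parallel.
  by apply/eqP; rewrite -subr_eq0; apply/eqP.
have [abc|abc] := ltP 0 (orient a b c).
  have [ab bc s0] := balanced_triangle abc E bO.
  by exists a, b, c; split=> //; rewrite s0 scaler0.
(* A clockwise triangle becomes counterclockwise by exchanging two vertices. *)
have E' : Omega = conv_hull [set b; a; c].
  by rewrite E; congr conv_hull; apply/seteqP; split => x /=; tauto.
have bac : 0 < orient b a c by rewrite orient_swap oppr_gt0 lt_def eq_sym abc0.
have [ba ac s0] := balanced_triangle bac E' bO.
exists b, a, c; split=> //; last by rewrite s0 scaler0.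
split=> // C; move: bac; rewrite /orient /cross.
by move: C; rewrite /collinear /parallel => ->; rewrite subrr ltxx.
Qed.

(** Writing [c = a + t (b - a)], the middle point is [a], [c] or [b] according as [t < 0],
    [0 <= t <= 1] or [t > 1]. *)
Lemma collinear_between a b c : orient a b c = 0 ->
  [\/ conv_hull [set b; c] a, conv_hull [set a; c] b | conv_hull [set a; b] c].
Proof.
move=> abc; have [->|ab] := eqVneq a b.
  by apply: Or31; apply: conv_hull_sub; left.
have l0 : 0 < dot (b - a) (b - a).
  by rewrite -sqrtr_gt0; exact: edge_length_gt0.
pose t := dot (b - a) (c - a) / dot (b - a) (b - a).
have Ec : c = t *: b + (1 - t) *: a.
  apply/eqP; rewrite -subr_eq0; apply/eqP.
  apply: (@dot_basis_eq0 _ (b - a) (- (b - a).2, (b - a).1)).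
  - have -> : cross (b - a) (- (b - a).2, (b - a).1) = dot (b - a) (b - a).
      by rewrite /cross /dot /=; ring.
    by rewrite gt_eqF.
  - transitivity (dot (b - a) (c - a) - t * dot (b - a) (b - a)).
      by rewrite /dot /= /GRing.scale /=; ring.
    by rewrite divfK ?subrr // gt_eqF.
  - by rewrite -abc /orient /cross /dot /= /GRing.scale /=; ring.
have [t0|t0] := ltP t 0.
  apply: Or31.
  have -> : a = (- t / (1 - t)) *: b + (1 - - t / (1 - t)) *: c.
    have t1N : 1 - t != 0 by rewrite gt_eqF //; lra.
    rewrite Ec; case: a b {Ec abc ab l0 t0} @t t1N => [a1 a2] [b1 b2] t t1N.
    by congr pair; rewrite /= /GRing.scale /=; field.
  apply: conv_hull_conv; [|by apply: conv_hull_sub; left|by apply: conv_hull_sub; right].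
  by rewrite divr_ge0 ?ler_pdivrMr /=; lra.
have [t1|t1] := leP t 1.
  apply: Or33; rewrite Ec; apply: conv_hull_conv; first by rewrite t0.
    by apply: conv_hull_sub; right.
  by apply: conv_hull_sub; left.
apply: Or32.
have -> : b = t^-1 *: c + (1 - t^-1) *: a.
  have tN : t != 0 by rewrite gt_eqF //; lra.
  rewrite Ec; case: a b {Ec abc ab l0 t0 t1} @t tN => [a1 a2] [b1 b2] t tN.
  by congr pair; rewrite /= /GRing.scale /=; field.
apply: conv_hull_conv; [|by apply: conv_hull_sub; right|by apply: conv_hull_sub; left].
by rewrite invr_ge0 t0 /= invf_le1 //; lra.
Qed.

(** With the next two lemmas, adjacent transpositions give every reordering of the vertices. *)
Lemma convex_quadrangle_swap12 a b c d Omega :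
  convex_quadrangle_with a b c d Omega -> convex_quadrangle_with b a c d Omega.
Proof.
move=> [ha hb hc hd E]; split=> //.
- by have -> : [set b; a; d] = [set a; b; d] by apply/seteqP; split => x /=; tauto.
- by have -> : [set b; a; c] = [set a; b; c] by apply/seteqP; split => x /=; tauto.
- by rewrite E; congr conv_hull; apply/seteqP; split => x /=; tauto.
Qed.

Lemma convex_quadrangle_swap23 a b c d Omega :
  convex_quadrangle_with a b c d Omega -> convex_quadrangle_with a c b d Omega.
Proof.
move=> [ha hb hc hd E]; split=> //.
- by have -> : [set c; b; d] = [set b; c; d] by apply/seteqP; split => x /=; tauto.
- by have -> : [set a; c; b] = [set a; b; c] by apply/seteqP; split => x /=; tauto.
- by rewrite E; congr conv_hull; apply/seteqP; split => x /=; tauto.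
Qed.

Lemma convex_quadrangle_swap34 a b c d Omega :
  convex_quadrangle_with a b c d Omega -> convex_quadrangle_with a b d c Omega.
Proof.
move=> [ha hb hc hd E]; split=> //.
- by have -> : [set b; d; c] = [set b; c; d] by apply/seteqP; split => x /=; tauto.
- by have -> : [set a; d; c] = [set a; c; d] by apply/seteqP; split => x /=; tauto.
- by rewrite E; congr conv_hull; apply/seteqP; split => x /=; tauto.
Qed.

Lemma convex_quadrangle_orient a b c d Omega :
  convex_quadrangle_with a b c d Omega -> orient a b c != 0.
Proof.
move=> [ha hb hc _ _]; apply/eqP => /collinear_between [H|H|H].
- by apply: ha; apply: conv_hullS H => x /=; tauto.
- by apply: hb; apply: conv_hullS H => x /=; tauto.
- by apply: hc; apply: conv_hullS H => x /=; tauto.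
Qed.

(** With [orient a b c] positive, the signs of the three other triangles leave eight cases: three
    give a cyclic order, four put a vertex in the triangle of the others, and one contradicts
    [rel]. *)
Lemma convex_quadrangle_ccw a b c d Omega : convex_quadrangle_with a b c d Omega ->
  exists a' b' c' d', [/\ convex_quadrangle_with a' b' c' d' Omega,
    0 < orient a' b' c', 0 < orient b' c' d', 0 < orient c' d' a' & 0 < orient d' a' b'].
Proof.
wlog abc : a b c d / 0 < orient a b c => [W Q|Q].
  have [|abc] := ltP 0 (orient a b c); first by move=> abc; exact: W abc Q.
  have abc0 := convex_quadrangle_orient Q.
  apply: (W b a c d); last exact: convex_quadrangle_swap12.
  by rewrite orient_swap oppr_gt0 lt_def eq_sym abc0.
have Qabdc := convex_quadrangle_swap34 Q.
have Qadbc := convex_quadrangle_swap23 Qabdc.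
have abd0 := convex_quadrangle_orient Qabdc.
have acd0 := convex_quadrangle_orient (convex_quadrangle_swap34 (convex_quadrangle_swap23 Q)).
have bcd0 : orient b c d != 0.
  apply: (@convex_quadrangle_orient b c d a Omega).
  exact/convex_quadrangle_swap34/convex_quadrangle_swap23/convex_quadrangle_swap12.
case: (Q) => ha hb hc hd _.
(* The signed area computed by cutting along either diagonal. *)
have rel : orient a b c + orient a c d = orient a b d + orient b c d.
  by rewrite /orient /cross /=; ring.
have [adc dac cda cad] : [/\ orient a d c = - orient a c d, orient d a c = orient a c d,
    orient c d a = orient a c d & orient c a d = - orient a c d].
  by rewrite /orient /cross /=; split; ring.
have [adb dab bda dba] : [/\ orient a d b = - orient a b d, orient d a b = orient a b d,
    orient b d a = orient a b d & orient d b a = - orient a b d].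
  by rewrite /orient /cross /=; split; ring.
have [bdc cdb dbc dcb] : [/\ orient b d c = - orient b c d, orient c d b = orient b c d,
    orient d b c = orient b c d & orient d c b = - orient b c d].
  by rewrite /orient /cross /=; split; ring.
have [bca cab dca] : [/\ orient b c a = orient a b c, orient c a b = orient a b c &
    orient d c a = - orient a c d].
  by rewrite /orient /cross /=; split; ring.
have [abd|abd|/esym abd] := ltgtP 0 (orient a b d); last by rewrite abd eqxx in abd0.
- have [acd|acd|/esym acd] := ltgtP 0 (orient a c d); last by rewrite acd eqxx in acd0.
  + have [bcd|bcd|/esym bcd] := ltgtP 0 (orient b c d); last by rewrite bcd eqxx in bcd0.
    * by exists a, b, c, d; split=> //; lra.
    * by case: hc; apply: (@in_triangle _ _ a b d) => //=; (try tauto); lra.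
  + have [bcd|bcd|/esym bcd] := ltgtP 0 (orient b c d); last by rewrite bcd eqxx in bcd0.
    * by case: hd; apply: (@in_triangle _ _ a b c) => //=; (try tauto); lra.
    * by exists a, b, d, c; split=> //; lra.
- have [acd|acd|/esym acd] := ltgtP 0 (orient a c d); last by rewrite acd eqxx in acd0.
  + have [bcd|bcd|/esym bcd] := ltgtP 0 (orient b c d); last by rewrite bcd eqxx in bcd0.
    * by case: ha; apply: (@in_triangle _ _ b c d) => //=; (try tauto); lra.
    * by exfalso; move: rel abc abd acd bcd; clear => *; lra.
  + have [bcd|bcd|/esym bcd] := ltgtP 0 (orient b c d); last by rewrite bcd eqxx in bcd0.
    * by exists a, d, b, c; split=> //; lra.
    * by case: hb; apply: (@in_triangle _ _ a d c) => //=; (try tauto); lra.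
Qed.

Lemma balanced_quadrangle a b c d Omega :
  0 < orient a b c -> 0 < orient b c d -> 0 < orient c d a -> 0 < orient d a b ->
  Omega = conv_hull [set a; b; c; d] -> balance_law Omega -> a + c = 0 /\ b + d = 0.
Proof.
move=> abc bcd cda dab ->; rewrite conv_hull_quadrangle // => /balance_law_balanced bQ.
have {bQ} bQ := bQ (measurable_quadrangle_of _ _ _ _ _ _ _ _).
have nab := orient_neq abc; have nbc := orient_neq bcd.
have ncd := orient_neq cda; have nda := orient_neq dab.
have abd : orient a b d = orient d a b by rewrite orient_rot.
have bca : orient b c a = orient a b c by rewrite orient_rot.
have cdb : orient c d b = orient b c d by rewrite orient_rot.
have dac : orient d a c = orient c d a by rewrite orient_rot.
(* Midpoints of the sides serve as the points required on each side. *)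
pose mid u v : R * R := (2^-1 : R) *: (u + v).
have omid x y u v : orient x y (mid u v) = (orient x y u + orient x y v) / 2.
  by rewrite /mid /orient /cross /= /GRing.scale /=; field.
have mid_edge x y : dot (edge_normal x y) (mid x y) = edge_dist x y.
  by apply: edge_eq; rewrite omid orient1 orient2 addr0 mul0r.
have M0 : [/\ dot (edge_normal a b) (mid a b) = edge_dist a b,
    dot (edge_normal b c) (mid a b) < edge_dist b c,
    dot (edge_normal c d) (mid a b) < edge_dist c d &
    dot (edge_normal d a) (mid a b) < edge_dist d a].
  by rewrite !edge_lt // mid_edge !omid ?orient1 ?orient2; split=> //; lra.
have M1 : [/\ dot (edge_normal a b) (mid b c) < edge_dist a b,
    dot (edge_normal b c) (mid b c) = edge_dist b c,
    dot (edge_normal c d) (mid b c) < edge_dist c d &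
    dot (edge_normal d a) (mid b c) < edge_dist d a].
  by rewrite !edge_lt // mid_edge !omid ?orient1 ?orient2; split=> //; lra.
have M2 : [/\ dot (edge_normal a b) (mid c d) < edge_dist a b,
    dot (edge_normal b c) (mid c d) < edge_dist b c,
    dot (edge_normal c d) (mid c d) = edge_dist c d &
    dot (edge_normal d a) (mid c d) < edge_dist d a].
  by rewrite !edge_lt // mid_edge !omid ?orient1 ?orient2; split=> //; lra.
have M3 : [/\ dot (edge_normal a b) (mid d a) < edge_dist a b,
    dot (edge_normal b c) (mid d a) < edge_dist b c,
    dot (edge_normal c d) (mid d a) < edge_dist c d &
    dot (edge_normal d a) (mid d a) = edge_dist d a].
  by rewrite !edge_lt // mid_edge !omid ?orient1 ?orient2; split=> //; lra.
have [N2 N3 D2 D3] := balanced_quadrangle_normals (unit_edge_normal nab)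
  (unit_edge_normal nbc) (unit_edge_normal ncd) (unit_edge_normal nda)
  (cross_edge_normal abc) (cross_edge_normal bcd) (cross_edge_normal cda)
  (cross_edge_normal dab) M0 M1 M2 M3 bQ.
have c01 := lt0r_neq0 (cross_edge_normal abc).
have dotDr w u v : dot w (u + v) = dot w u + dot w v by rewrite /dot /=; ring.
have c2 : dot (edge_normal c d) c = edge_dist c d by [].
have d3 : dot (edge_normal d a) d = edge_dist d a by [].
have d2 := edge_eq (orient2 c d); have a3 := edge_eq (orient2 d a).
have b0 := edge_eq (orient2 a b); have c1 := edge_eq (orient2 b c).
move: c2 d2 d3 a3; rewrite N2 N3 D2 D3 !dotNl => c2 d2 d3 a3.
have a0 : dot (edge_normal a b) a = edge_dist a b by [].
have b1 : dot (edge_normal b c) b = edge_dist b c by [].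
(* Opposite vertices lie on opposite parallel sides at equal distances, so their sum is orthogonal
   to two independent normals. *)
by split; apply: (dot_basis_eq0 c01); rewrite dotDr; lra.
Qed.

Lemma quadrangle_parallelogram Omega : is_convex_quadrangle Omega -> balance_law Omega ->
  is_centered_parallelogram Omega.
Proof.
move=> [a [b [c [d /convex_quadrangle_ccw]]]].
move=> [{}a [{}b [{}c [{}d [Q abc bcd cda dab]]]]] bO.
have E : Omega = conv_hull [set a; b; c; d] by case: Q.
have [ac bd] := balanced_quadrangle abc bcd cda dab E bO.
exists a, b, c, d; rewrite ac bd !scaler0; split=> //; rewrite /parallel.
  have -> : c = - a by apply/eqP; rewrite -addr_eq0 addrC ac.
  have -> : d = - b by apply/eqP; rewrite -addr_eq0 addrC bd.
  by rewrite /=; ring.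
have -> : c = - a by apply/eqP; rewrite -addr_eq0 addrC ac.
have -> : d = - b by apply/eqP; rewrite -addr_eq0 addrC bd.
by rewrite /=; ring.
Qed.

End main.

Theorem theorem4p3 (R : realType) :
  (forall Omega : set (R * R),
     is_triangle Omega -> balance_law Omega ->
     is_centered_equilateral_triangle Omega) /\
  (forall Omega : set (R * R),
     is_convex_quadrangle Omega -> balance_law Omega ->
     is_centered_parallelogram Omega).
Proof.
by split; [exact: triangle_equilateral|exact: quadrangle_parallelogram].
Qed.
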